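(* Let $d\geq 2$, let $\mathsf{M}$ be a loopless matroid of rank $d+1$ and let $\Sigma_{\mathsf{M}}\subseteq N_{\mathbb{R}}$ be the associated Bergman fan. If $*\in\mathrm{Inn}(N_{\mathbb{R}})$ is any inner product with $\mathrm{Cub}(\Sigma_{\mathsf{M}},* )\neq\emptyset$, then $(\Sigma_{\mathsf{M}},* )$ is AF; that is, $$\mathrm{MVol}_{\Sigma_{\mathsf{M}},*}(z_1,z_2,z_3,\dots,z_d)^2\geq\mathrm{MVol}_{\Sigma_{\mathsf{M}},*}(z_1,z_1,z_3,\dots,z_d)\,\mathrm{MVol}_{\Sigma_{\mathsf{M}},*}(z_2,z_2,z_3,\dots,z_d)$$ for all $z_1,\dots,z_d\in\mathrm{Cub}(\Sigma_{\mathsf{M}},* )$.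
   Context: **Matroids and Bergman fans.** A (loopless) matroid $\mathsf{M}=(E,\mathcal{L})$ is a finite set $E$ with a collection $\mathcal{L}\subseteq 2^E$ of flats such that: $\emptyset\in\mathcal{L}$; $\mathcal L$ is closed under pairwise intersection; and for $F\in\mathcal{L}$, every element of $E\setminus F$ lies in exactly one flat that is minimal among the flats strictly containing $F$. The closure $\mathrm{cl}(S)$ of $S\subseteq E$ is the smallest flat containing $S$; $I\subseteq E$ is independent if $\mathrm{cl}(I_1)\subsetneq\mathrm{cl}(I_2)$ for all $I_1\subsetneq I_2\subseteq I$; the rank $\mathrm{rk}(S)$ is the maximal size of an independent subset of $S$, and the rank of $\mathsf{M}$ is $\mathrm{rk}(E)$. Let $\mathcal{L}^*=\mathcal{L}\setminus\{\emptyset,E\}$. Let $\mathbb{R}^E$ have basis $\{v_e\}_{e\in E}$, $v_S=\sum_{e\in S}v_e$, $N_{\mathbb{R}}=\mathbb{R}^E/\mathbb{R}v_E$, and let $u_S$ be the image of $v_S$ in $N_{\mathbb{R}}$. For a chain $\mathcal{F}=(F_1\subsetneq\cdots\subsetneq F_k)$ in $\mathcal{L}^*$ (possibly empty), let $\sigma_{\mathcal{F}}=\mathbb{R}_{\ge0}\{u_{F_1},\dots,u_{F_k}\}$. The Bergman fan $\Sigma_{\mathsf{M}}$ is the set of all cones $\sigma_{\mathcal{F}}$. It is simplicial, pure of dimension $\mathrm{rk}(\mathsf{M})-1$, and its rays $\rho_F=\mathbb R_{\ge 0}u_F$ are marked by the vectors $u_F$. **Mixed volumes.** Let $\Sigma$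 be a simplicial fan, pure of dimension $d$, in $N_{\mathbb{R}}$ with marked ray generators $u_\rho$, and $*\in\mathrm{Inn}(N_{\mathbb{R}})$ an inner product. $\Sigma(k)$ is the set of $k$-dimensional cones, $\sigma(1)$ the set of rays of $\sigma$, $\sigma^\circ$ the relative interior and $N_{\sigma,\mathbb{R}}$ the linear span of $\sigma$. For $z\in\mathbb{R}^{\Sigma(1)}$, $w_{\sigma,*}(z)\in N_{\sigma,\mathbb{R}}$ is the unique vector with $w_{\sigma,*}(z)*u_\rho=z_\rho$ for all $\rho\in\sigma(1)$. $\mathrm{Cub}(\Sigma,* )$ is the set of $z\in\mathbb{R}^{\Sigma(1)}$ with $w_{\sigma,*}(z)\in\sigma^\circ$ for all $\sigma\in\Sigma$. Let $P_{\sigma,*}(z)=\{v\in\sigma\mid v*u_\rho\le z_\rho\text{ for all }\rho\in\sigma(1)\}$. Let $M_\sigma\subseteq N_{\sigma,\mathbb{R}}$ be the lattice spanned by the basis dual to $\{u_\rho\mid\rho\in\sigma(1)\}$ with respect to $*$; $\mathrm{Vol}_\sigma$ is the volume on $N_{\sigma,\mathbb{R}}$ normalized so that a fundamental simplex of $M_\sigma$ (convex hull of $0$ and a lattice basis) has volume $1$, and $\mathrm{MVol}_\sigma$ is the associated mixed volume of polytopes (symmetric, Minkowski-multilinear, $\mathrm{MVol}_\sigma(P,\dots,P)=\mathrm{Vol}_\sigma(P)$). Then $$\mathrm{MVol}_{\Sigma,*}(z_1,\dots,z_d)=\sum_{\sigma\in\Sigma(d)}\mathrm{MVol}_\sigma(P_{\sigma,*}(z_1),\dots,P_{\sigma,*}(z_d)).$$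 *)

(* Defs.v *)
From HB Require Import structures.
From mathcomp Require Import all_boot all_order all_algebra perm.
From mathcomp Require Import all_classical all_reals all_analysis.

Set Implicit Arguments.
Unset Strict Implicit.
Unset Printing Implicit Defensive.

Import Order.TTheory GRing.Theory Num.Theory.

Local Open Scope classical_set_scope.
Local Open Scope ring_scope.

Section Matroids.
Variable E : finType.
Implicit Types (S I F G : {set E}) (L : {set {set E}}).

Definition covers L F G : bool :=
  minset [pred H : {set E} | (H \in L) && (F \proper H)] G.

Record matroid := Matroid {
  flats : {set {set E}};
  flats0 : finset.set0 \in flats;
  flatsI : forall F G, F \in flats -> G \in flats -> (F :&: G)%SET \in flats;
  flats_cover : forall F (e : E), F \in flats -> e \notin F ->
    exists! G, covers flats F G /\ e \in G }.

Variable M : matroid.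

Definition cl S : {set E} := (\bigcap_(F in flats M | S \subset F) F)%SET.

Definition independent I : bool :=
  [forall I1 : {set E}, forall I2 : {set E},
    (I1 \proper I2) && (I2 \subset I) ==> (cl I1 \proper cl I2)].

Definition rk S : nat :=
  (\max_(I : {set E} | independent I && (I \subset S)) #|I|)%N.

Definition matroid_rank : nat := rk [set: E]%SET.

Definition proper_flats : {set {set E}} := (flats M :\: [set finset.set0; [set: E]])%SET.

End Matroids.

Section Polytopes.
Variables (R : realType) (N : vectType R).

Definition convex_hull (I : finType) (p : I -> N) : set N :=
  [set v | exists a : I -> R, [/\ forall i, 0 <= a i, \sum_i a i = 1 &
    v = \sum_i a i *: p i]].

(* The index type is inhabited, so polytopes are nonempty; Minkowski additivity
   of the mixed volume would fail for the empty set. *)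
Definition polytope (U : {vspace N}) (P : set N) : Prop :=
  exists (I : finType) (i0 : I) (p : I -> N),
    (forall i, p i \in U) /\ P = convex_hull p.

Definition minkowski_comb (a : R) (A : set N) (b : R) (B : set N) : set N :=
  [set a *: x + b *: y | x in A & y in B].

Definition minkowski_sum d (P : 'I_d -> set N) (S : {set 'I_d}) : set N :=
  [set \sum_(i in S) x i | x in [set x : 'I_d -> N | forall i, P i (x i)]].

Record is_mixed_volume (U : {vspace N}) (vol : set N -> R) d
    (mv : ('I_d -> set N) -> R) : Prop := {
  mixed_volume_sym : forall (P : 'I_d -> set N) (s : 'S_d),
    (forall i, polytope U (P i)) -> mv (P \o s) = mv P;
  mixed_volume_linear : forall (P : 'I_d -> set N) (i : 'I_d) A B (a b : R),
    (forall j, polytope U (P j)) -> polytope U A -> polytope U B ->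
    0 <= a -> 0 <= b ->
    mv (dfwith P i (minkowski_comb a A b B)) =
      a * mv (dfwith P i A) + b * mv (dfwith P i B);
  mixed_volume_diag : forall P, polytope U P -> mv (fun=> P) = vol P }.

Definition polarization (vol : set N -> R) d (P : 'I_d -> set N) : R :=
  d`!%:R^-1 *
  \sum_(S : {set 'I_d}) (-1) ^+ (d - #|S|) * vol (minkowski_sum P S).

(* Lemma mixed_volumeE below shows that the three properties determine the
   values on polytopes, as given by the polarization formula; that formula also
   serves as the default value of xget. *)
Definition mixed_volume (U : {vspace N}) (vol : set N -> R) d :
    ('I_d -> set N) -> R :=
  xget (polarization vol (d := d)) [set mv | is_mixed_volume U vol mv].

Section Uniqueness.
Variable U : {vspace N}.

Lemma polytope0 : polytope U [set 0].
Proof.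
exists unit, tt, (fun=> 0); split=> [_|]; first exact: mem0v.
apply/seteqP; split=> v /=.
  by move=> ->; exists (fun=> 1); split; rewrite ?big_const ?card_unit //= ?addr0 ?scaler0 ?addr0.
by case=> a [_ _ ->]; rewrite big1 // => i _; rewrite scaler0.
Qed.

Lemma polytope_nonempty P : polytope U P -> P !=set0.
Proof.
case=> I [i0 [p [_ ->]]]; exists (p i0), (fun i => (i == i0)%:R); split=> //.
- by rewrite (bigD1 i0) //= eqxx big1 ?addr0 // => i /negPf->.
- rewrite (bigD1 i0) //= eqxx scale1r big1 ?addr0 // => i /negPf->.
  by rewrite scale0r.
Qed.

Lemma polytopeD A B : polytope U A -> polytope U B ->
  polytope U (minkowski_comb 1 A 1 B).
Proof.
case=> I [i0 [p [pU ->]]] [J [j0 [q [qU ->]]]].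
exists (I * J)%type, (i0, j0), (fun k => p k.1 + q k.2); split.
  by move=> k; rewrite memvD.
apply/seteqP; split=> v /=.
  case=> x [a [a0 a1 ->]] [y [b [b0 b1 ->]]] <-.
  exists (fun k => a k.1 * b k.2); split.
  - by move=> k; rewrite mulr_ge0.
  - rewrite -(pair_bigA _ (fun i j => a i * b j)) /= -a1.
    by apply: eq_bigr => i _; rewrite -mulr_sumr b1 mulr1.
  - rewrite !scale1r -(pair_bigA _ (fun i j => (a i * b j) *: (p i + q j))) /=.
    under [RHS]eq_bigr do under eq_bigr do rewrite scalerDr.
    under [RHS]eq_bigr do rewrite big_split /=.
    rewrite big_split /=; congr (_ + _).
      apply: eq_bigr => i _; rewrite -scaler_suml -mulr_sumr b1 mulr1 //.
    rewrite exchange_big /=; apply: eq_bigr => j _.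
    by rewrite -scaler_suml -mulr_suml a1 mul1r.
case=> c [c0 c1 ->].
exists (\sum_i (\sum_j c (i, j)) *: p i).
  exists (fun i => \sum_j c (i, j)); split=> //.
    by move=> i; rewrite sumr_ge0.
  by rewrite -c1 pair_bigA /=; apply: eq_bigr => -[].
exists (\sum_j (\sum_i c (i, j)) *: q j).
  exists (fun j => \sum_i c (i, j)); split=> //.
    by move=> i; rewrite sumr_ge0.
  by rewrite exchange_big -c1 pair_bigA /=; apply: eq_bigr => -[].
rewrite !scale1r.
under eq_bigr do rewrite scaler_suml.
under [X in _ + X]eq_bigr do rewrite scaler_suml.
rewrite [X in _ + X]exchange_big !pair_bigA -big_split /=.
by apply: eq_bigr => -[i j] _ /=; rewrite scalerDr.
Qed.

Section Fixed.
Variables (d : nat) (P : 'I_d -> set N).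
Hypothesis PU : forall i, polytope U (P i).

Lemma minkowski_sum0 : minkowski_sum P finset.set0 = [set 0].
Proof.
have [x Px] := choice (fun i => polytope_nonempty (PU i)).
apply/seteqP; split=> v /=; first by case=> y _ <-; rewrite big_set0.
by move=> ->; exists x => //; rewrite big_set0.
Qed.

Lemma minkowski_sumU1 i (S : {set 'I_d}) : i \notin S ->
  minkowski_sum P (i |: S)%SET = minkowski_comb 1 (P i) 1 (minkowski_sum P S).
Proof.
move=> iS; apply/seteqP; split=> v /=.
  case=> x Px <-; exists (x i) => //; exists (\sum_(j in S) x j); first by exists x.
  by rewrite big_setU1 //= !scale1r.
case=> y Py [_ [x Px <-] <-]; rewrite !scale1r.
exists (dfwith x i y).
  by move=> j; case: dfwithP.
rewrite big_setU1 //= dfwithin; congr (_ + _).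
by apply: eq_bigr => j jS; rewrite dfwithout //; apply: contraNneq iS => ->.
Qed.

Lemma minkowski_sum1 i : minkowski_sum P [set i]%SET = P i.
Proof.
rewrite -(finset.setU0 [set i]%SET) minkowski_sumU1 ?inE // minkowski_sum0.
apply/seteqP; split=> v /=.
  by case=> x Px [_ -> <-]; rewrite scaler0 addr0 scale1r.
by move=> Pv; exists v => //; exists 0 => //; rewrite scaler0 addr0 scale1r.
Qed.

Lemma polytope_minkowski_sum S : polytope U (minkowski_sum P S).
Proof.
elim: {S}_.+1 {-2}S (ltnSn #|S|) => // n IH S.
have [->|[i iS]] := set_0Vmem S; first by rewrite minkowski_sum0 => _; exact: polytope0.
rewrite (cardsD1 i) iS add1n ltnS => Sn.
rewrite -(finset.setD1K iS) minkowski_sumU1 ?finset.setD11 //.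
by apply: polytopeD => //; apply: IH.
Qed.

Variables (vol : set N -> R) (mv : ('I_d -> set N) -> R).
Hypothesis mvP : is_mixed_volume U vol mv.

Let m (A : 'I_d -> {set 'I_d}) := mv (fun i => minkowski_sum P (A i)).

Let m_dfwith A i (B : {set 'I_d}) : m (dfwith A i B) =
  mv (dfwith (fun i => minkowski_sum P (A i)) i (minkowski_sum P B)).
Proof.
congr mv; apply: funext => j; have [<-|ij] := eqVneq i j.
  by rewrite !dfwithin.
by rewrite !dfwithout.
Qed.

Let dfwith_id (T : Type) (f : 'I_d -> T) i : dfwith f i (f i) = f.
Proof.
apply: funext => j; have [<-|ij] := eqVneq i j; first by rewrite dfwithin.
by rewrite dfwithout.
Qed.

Lemma mixed_volume_expand (A : 'I_d -> {set 'I_d}) :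
  m A = \sum_(f : {ffun 'I_d -> 'I_d} | [forall i, f i \in A i]) mv (P \o f).
Proof.
elim: {A}_.+1 {-2}A (ltnSn (\sum_i #|A i|)%N) => // n IH A.
rewrite ltnS => An.
have [/forallP A1|] := boolP [forall i, #|A i| == 1%N].
  have [f Af] := choice (fun i => elimT cards1P (A1 i)).
  rewrite (big_pred1 (finfun f)) => [|g /=]; last first.
    apply/forallP/eqP => [Ag|-> i]; last by rewrite ffunE Af inE.
    by apply/ffunP => i; rewrite ffunE; have := Ag i; rewrite Af inE => /eqP.
  by congr mv; apply: funext => i /=; rewrite Af minkowski_sum1 ffunE.
rewrite negb_forall => /existsP[i Ai].
have PA j : polytope U (minkowski_sum P (A j)) by exact: polytope_minkowski_sum.
have [A0|[k kA]] := set_0Vmem (A i).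
  rewrite [RHS]big_pred0 => [|f]; last by apply/negP => /forallP/(_ i); rewrite A0 inE.
  rewrite -(dfwith_id A i) m_dfwith A0 minkowski_sum0.
  suff -> : [set 0] = minkowski_comb 0 (P i) 0 (P i).
    by rewrite (mixed_volume_linear mvP) // !mul0r addr0.
  have [x Px] := polytope_nonempty (PU i).
  apply/seteqP; split=> v /=.
    by move=> ->; exists x => //; exists x => //; rewrite !scale0r addr0.
  by case=> y _ [z _ <-]; rewrite !scale0r addr0.
rewrite -(dfwith_id A i) m_dfwith -{1}(finset.setD1K kA) minkowski_sumU1 ?finset.setD11 //.
rewrite (mixed_volume_linear mvP) //; last exact: polytope_minkowski_sum.
rewrite !mul1r -{1}(minkowski_sum1 k) -!m_dfwith.
have card B : (\sum_j #|dfwith A i B j| = #|B| + \sum_(j | j != i) #|A j|)%N.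
  rewrite (bigD1 i) //= dfwithin; congr addn.
  by apply: eq_bigr => j ji; rewrite dfwithout // eq_sym.
have cardA : (\sum_j #|A j| = #|A i| + \sum_(j | j != i) #|A j|)%N by rewrite (bigD1 i).
have cardAi := cardsD1 k (A i); rewrite kA add1n in cardAi.
have Ak0 : (0 < #|(A i :\ k)%SET|)%N.
  by rewrite lt0n; apply: contraNneq Ai => Ai0; rewrite cardAi Ai0.
rewrite !IH; last 2 first.
- by rewrite card; apply: leq_trans An; rewrite cardA ltn_add2r cardAi.
- rewrite card; apply: leq_trans An; rewrite cardA ltn_add2r cardAi cards1.
  by rewrite ltnS.
rewrite dfwith_id [RHS](bigID (fun f : {ffun _} => f i == k)) /=.
congr (_ + _); apply: eq_bigl => f; apply/forallP/andP.
- move=> H; have := H i; rewrite dfwithin inE => /eqP fk; split; last by rewrite fk.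
  apply/forallP => j; have [<-|ij] := eqVneq i j; first by rewrite fk.
  by have := H j; rewrite dfwithout.
- case=> /forallP H fk j; case: dfwithP => [|j' ij]; first by rewrite inE.
  exact: H.
- move=> H; have := H i; rewrite dfwithin !inE => /andP[fk fA]; split=> //.
  apply/forallP => j; have [<-|ij] := eqVneq i j => //.
  by have := H j; rewrite dfwithout.
- case=> /forallP H fk j; case: dfwithP => [|j' ij]; last exact: H.
  by rewrite !inE fk H.
Qed.

Let alternating (A : {set 'I_d}) :
  \sum_(S : {set 'I_d} | A \subset S) (-1) ^+ (d - #|S|) =
    (A == [set: 'I_d]%SET)%:R :> R.
Proof.
have [->|AT] := eqVneq A [set: 'I_d]%SET.
  rewrite (big_pred1 [set: 'I_d]%SET) => [|S]; last by rewrite finset.subTset.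
  by rewrite cardsT card_ord subnn.
have [x xA] : exists x, x \notin A.
  apply/existsP; apply: contraNT AT; rewrite negb_exists => /forallP H.
  by apply/eqP/setP => x; rewrite !inE; have := H x; rewrite negbK.
rewrite (bigID (fun S : {set 'I_d} => x \in S)) /=.
rewrite (reindex_onto (fun S => x |: S)%SET (fun S => S :\ x)%SET) /=; last first.
  by move=> S /andP[_ xS]; rewrite finset.setD1K.
rewrite (eq_bigl (fun S : {set 'I_d} => (A \subset S) && (x \notin S))); last first.
  move=> S; rewrite finset.setU11 andbT; apply/andP/andP => -[AS].
    move=> /eqP SE; have xS : x \notin S by rewrite -SE finset.setD11.
    split=> //; rewrite -SE; apply/fintype.subsetP => y yA; rewrite !inE.
    have := fintype.subsetP AS y yA; rewrite !inE => ->.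
    by rewrite andbT; apply: contraNneq xA => <-.
  move=> xS; rewrite finset.setU1K // eqxx; split=> //.
  by apply: fintype.subset_trans AS _; exact: finset.subsetUr.
rewrite -big_split big1 //= => S /andP[_ xS].
have Sd : (#|S| < d)%N.
  by rewrite -[X in (_ < X)%N]card_ord -cardsT proper_card // properT; apply: contraNneq xS => ->; rewrite inE.
by rewrite cardsU1 xS add1n -[in X in _ + X](subnSK Sd) exprS mulN1r subrr.
Qed.

Lemma is_mixed_volume_polarization : mv P = polarization vol P.
Proof.
have volE (S : {set 'I_d}) : vol (minkowski_sum P S) =
    \sum_(f : {ffun 'I_d -> 'I_d} | (f @: 'I_d)%SET \subset S) mv (P \o f).
  rewrite -(mixed_volume_diag mvP (polytope_minkowski_sum S)).
  transitivity (m (fun=> S)) => //; rewrite mixed_volume_expand.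
  apply: eq_bigl => f; apply/forallP/fintype.subsetP => [H _ /imsetP[i _ ->] //|H i].
  by apply: H; exact: imset_f.
rewrite /polarization; under eq_bigr do rewrite volE mulr_sumr.
rewrite (exchange_big_dep predT) //=.
under eq_bigr do rewrite -mulr_suml alternating.
rewrite (bigID (fun f : {ffun 'I_d -> 'I_d} => injectiveb f)) /=.
have injT (f : {ffun 'I_d -> 'I_d}) :
    ((f @: 'I_d)%SET == [set: 'I_d]%SET) = injectiveb f.
  apply/eqP/injectiveP => [fT|finj].
    have /imset_injP finj : #|(f @: 'I_d)%SET| == #|'I_d| by rewrite fT cardsT.
    by move=> x y; exact: finj.
  by apply/eqP; rewrite eqEcard finset.subsetT cardsT card_imset //= leqnn.
rewrite [X in _ + X]big1 ?addr0 => [|f /negPf fN]; last by rewrite injT fN mul0r.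
rewrite (eq_bigr (fun=> mv P)) => [|f finj]; last first.
  rewrite injT finj mul1r -[RHS](mixed_volume_sym mvP (perm (injectiveP _ finj)) PU).
  by congr mv; apply: funext => i /=; rewrite permE.
rewrite big_const iter_addr_0 -[X in mv P *+ X]cardsE card_inj_ffuns.
by rewrite card_ord ffactnn -[X in _ * X]mulr_natl mulKf // pnatr_eq0 -lt0n fact_gt0.
Qed.

End Fixed.

Lemma mixed_volumeE vol d (P : 'I_d -> set N) :
  (forall i, polytope U (P i)) -> mixed_volume U vol P = polarization vol P.
Proof.
move=> PU; rewrite /mixed_volume; case: xgetP => // mv _ mvP.
exact: is_mixed_volume_polarization PU _ _ mvP.
Qed.

End Uniqueness.
End Polytopes.

(* Lebesgue measure on R^n as the iterated product of lebesgue_measure, i.e.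
   computed by integrating over slices; meant for Borel sets. *)
Fixpoint lebesgue_vol (R : realType) (n : nat) : set (n.-tuple R) -> \bar R :=
  match n with
  | 0%N => fun A => (\1_A [tuple])%:E
  | m.+1 => fun A =>
      (\int[@lebesgue_measure R]_x
         lebesgue_vol [set t : m.-tuple R | A [tuple of x :: t]])%E
  end.

(* A simplicial fan with marked rays is recorded through its rays, their marked
   generators, and its cones, each cone being given by its set of rays. *)
Record marked_fan (R : realType) (N : vectType R) := MarkedFan {
  ray : finType;
  gen : ray -> N;
  cones : {set {set ray}} }.

Section NormalComplexes.
Variables (R : realType) (N : vectType R) (Sigma : marked_fan N).
Variable ip : {dot N for idfun}.
Implicit Types (s : {set ray Sigma}) (z : ray Sigma -> R) (v w : N).

Definition cone s : set N :=
  [set \sum_(r in s) a r *: gen r |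
    a in [set a : ray Sigma -> R | forall r, 0 <= a r]].

Definition cone_span s : {vspace N} := <<[seq gen r | r <- enum s]>>%VS.

Definition cones_of_dim (k : nat) : {set {set ray Sigma}} :=
  [set s in cones Sigma | \dim (cone_span s) == k]%SET.

(* Interior of the cone in its linear span, for the norm defined by ip. *)
Definition cone_relint s : set N :=
  [set v | v \in cone_span s /\ exists2 e : R, 0 < e &
    forall w, w \in cone_span s -> ip (w - v) (w - v) < e ^+ 2 -> cone s w].

Definition w_ s z : N :=
  xget 0 [set w | w \in cone_span s /\
                  forall r, r \in s -> ip w (gen r) = z r].

Definition Cub : set (ray Sigma -> R) :=
  [set z | forall s, s \in cones Sigma -> cone_relint s (w_ s z)].

Definition P_ s z : set N :=
  [set v | cone s v /\ forall r, r \in s -> ip v (gen r) <= z r].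

Definition dual_basis s (r : ray Sigma) : N := w_ s (fun r' => (r' == r)%:R).

(* Volume of the coordinates in a basis of M_s, times k! since the standard
   simplex of R^k has Lebesgue measure 1/k!. *)
Definition Vol_ s (A : set N) : R :=
  (#|s|)`!%:R * fine (lebesgue_vol
    [set t : #|s|.-tuple R |
       A (\sum_(i < #|s|) tnth t i *: dual_basis s (enum_val i))]).

Definition MVol_ d s : ('I_d -> set N) -> R :=
  mixed_volume (cone_span s) (Vol_ s) (d := d).

Definition MVol d (z : 'I_d -> ray Sigma -> R) : R :=
  \sum_(s in cones_of_dim d) MVol_ s (fun i => P_ s (z i)).

(* With i, j the first two positions, dfwith z j (z i) is (z1,z1,z3,...,zd)
   and dfwith z i (z j) is (z2,z2,z3,...,zd). *)
Definition AF d : Prop :=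
  forall (z : 'I_d -> ray Sigma -> R) (i j : 'I_d),
    i = 0%N :> nat -> j = 1%N :> nat -> (forall k, Cub (z k)) ->
    MVol z ^+ 2 >= MVol (dfwith z j (z i)) * MVol (dfwith z i (z j)).

End NormalComplexes.

Arguments Cub {R N} Sigma ip _.
Arguments MVol {R N} Sigma ip d z.
Arguments AF {R N} Sigma ip d.

Section Bergman.
Variables (R : realType) (E : finType) (M : matroid E).

Definition v_ (S : {set E}) : {ffun E -> R^o} := [ffun e => (e \in S)%:R].

(* N together with the linear map q is a quotient of R^E by the line R v_E. *)
Definition is_quotient_by_vE (N : vectType R)
    (q : 'Hom({ffun E -> R^o}, N)) : Prop :=
  limg q = fullv /\ lker q = <[v_ [set: E]%SET]>%VS.

Variables (N : vectType R) (q : 'Hom({ffun E -> R^o}, N)).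

Definition bergman_fan : marked_fan N :=
  @MarkedFan R N {F : {set E} | F \in proper_flats M}
    (fun F => q (v_ (val F)))
    [set C : {set {F : {set E} | F \in proper_flats M}} |
       [forall F in C, forall G in C,
          (val F \subset val G) || (val G \subset val F)]]%SET.

End Bergman.

(* Main.v *)
(* For cubical z the polytope P_s(z) splits into pyramids with apex 0 over its
   outer facets; likewise its face cut out by the constraints of a cone t of s
   splits into pyramids with apex w_t(z).  This gives a recursive formula for the
   volume, expanding over the rays r of the link of t with weights
   z_r - w_t(z) * u_r.  Summed over the maximal cones and polarized, it becomes a
   recursive formula, symmetric and multilinear in z_1, ..., z_d, for the mixed
   volume of the star of each cone t.

   The inequality says that the quadratic form B(x, y) of a star with the remaining
   arguments v, z_4, ... fixed is hyperbolic.  By induction on the codimension of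
   the cone it holds in the stars of codimension one less, which gives
   B(y, y) <= sum_r v_r b_r(y)^2 / b_r(v), where b_r(y) is the mixed volume of the
   star of r with first argument y.  In the inner product with weights b_r(v) / v_r
   the form is 1 - C, where C >= 0 has only multiples of v in its kernel, by
   connectivity of the link, and C^2 >= C by the induction hypothesis; so C >= 1,
   that is B <= 0, on the orthogonal of v.

   The induction starts with the two-dimensional stars.  For a Bergman fan these
   are given by chains of flats omitting two ranks, and balancing removes the inner
   product from the form, which is then visibly hyperbolic. *)

Require Import Defs.
From HB Require Import structures.
From mathcomp Require Import all_boot all_order all_algebra.
From mathcomp Require Import all_classical all_reals all_analysis.
From mathcomp Require Import measurable_realfun zify ring lra.

Set Implicit Arguments.
Unset Strict Implicit.
Unset Printing Implicit Defensive.

Import Order.TTheory GRing.Theory Num.Theory.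
Import numFieldNormedType.Exports.

Local Open Scope classical_set_scope.
Local Open Scope ring_scope.

(** * Volumes by slices *)

Section LebesgueVol.
Variable R : realType.
Local Notation leb := (@lebesgue_measure R).
Local Notation T := (Real.sort R).
Local Open Scope ereal_scope.

Definition tcons n (x : T) (t : n.-tuple T) : n.+1.-tuple T := [tuple of x :: t].

Lemma measurable_tcons n d (S : measurableType d) (f : S -> T) (g : S -> n.-tuple T) :
  measurable_fun setT f -> measurable_fun setT g ->
  measurable_fun setT (fun s => tcons (f s) (g s)).
Proof. exact: measurable_cons. Qed.

Lemma lebesgue_vol_ge0 n (A : set (n.-tuple R)) : 0 <= lebesgue_vol A.
Proof.
elim: n A => [|n IH] A /=; first by rewrite lee_fin.
exact: integral_ge0.
Qed.

Lemma preimage_measurable d1 d2 (S : measurableType d1) (U : measurableType d2) (f : S -> U)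
  (A : set U) : measurable_fun setT f -> measurable A -> measurable (f @^-1` A).
Proof. by move=> mf mA; rewrite -[X in measurable X]setTI; exact: mf. Qed.

Lemma measurable_section_vol n d (S : measurableType d) (D : set (S * n.-tuple T)) :
  measurable D ->
  measurable_fun setT ((fun s => lebesgue_vol [set t : n.-tuple R | D (s, t)]) : S -> \bar R).
Proof.
elim: n d S D => [|n IH] d S D mD /=.
  apply/measurable_EFinP.
  rewrite [X in measurable_fun _ X](_ : _ = \1_[set s | D (s, [tuple])]).
    apply: measurable_indic.
    apply: (@preimage_measurable _ _ S _ (fun s => (s, [tuple] : 0.-tuple T))) => //.
  by apply/funext => s; rewrite !indicE.
pose f (p : S * T) := lebesgue_vol [set t : n.-tuple R | D (p.1, tcons p.2 t)].
have mf : measurable_fun setT f.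
  apply: (IH _ _ [set q : S * T * n.-tuple T | D (q.1.1, tcons q.1.2 q.2)]).
  apply: (@preimage_measurable _ _ _ _
    (fun q : S * T * n.-tuple T => (q.1.1, tcons q.1.2 q.2))) => //.
  apply: measurable_fun_pair.
    by apply: (measurableT_comp measurable_fst) => //; exact: measurable_fst.
  apply: measurable_tcons => //.
  by apply: (measurableT_comp measurable_snd) => //; exact: measurable_fst.
apply: (@measurable_fun_fubini_tonelli_F _ _ _ _ _ leb f mf).
by move=> p; exact: lebesgue_vol_ge0.
Qed.

Lemma measurable_slice_vol n (A : set (n.+1.-tuple T)) : measurable A ->
  measurable_fun setT
    ((fun x => lebesgue_vol [set t : n.-tuple R | A (tcons x t)]) : T -> \bar R).
Proof.
move=> mA; apply: (@measurable_section_vol n _ T [set q : T * n.-tuple T | A (tcons q.1 q.2)]).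
apply: (@preimage_measurable _ _ _ _ (fun q : T * n.-tuple T => tcons q.1 q.2)) => //.
exact: measurable_tcons.
Qed.

Lemma measurable_slice n (A : set (n.+1.-tuple T)) x : measurable A ->
  measurable [set t : n.-tuple T | A (tcons x t)].
Proof.
move=> mA; apply: (@preimage_measurable _ _ _ _ (fun t : n.-tuple T => tcons x t)) => //.
exact: measurable_tcons.
Qed.

Lemma lebesgue_vol_sum n k (A : set (n.-tuple T)) (B : 'I_k -> set (n.-tuple T)) :
  (forall i, measurable (B i)) ->
  (forall t, \1_A t = \sum_(i < k) \1_(B i) t :> R)%R ->
  lebesgue_vol A = \sum_(i < k) lebesgue_vol (B i).
Proof.
elim: n A B => [|n IH] A B mB AB /=; first by rewrite AB sumEFin.
rewrite -ge0_integral_sum //; last 2 first.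
- by move=> i; exact: (@measurable_slice_vol n (B i)).
- by move=> i x _; exact: lebesgue_vol_ge0.
apply: eq_integral => x _; apply: IH => [i|t]; first exact: (@measurable_slice n (B i)).
exact: (AB (tcons x t)).
Qed.

End LebesgueVol.

Section Ins.
Variable R : realType.
Local Notation leb := (@lebesgue_measure R).
Local Notation T := (Real.sort R).
Local Open Scope ereal_scope.

Definition tins n (i : 'I_n.+1) (x : R) (t : n.-tuple R) : n.+1.-tuple R :=
  [tuple if unlift i j is Some k then tnth t k else x | j < n.+1].

Lemma tnth_tins n i x t : tnth (@tins n i x t) i = x.
Proof. by rewrite tnth_mktuple unlift_none. Qed.

Lemma tnth_tins_lift n i x t k : tnth (@tins n i x t) (lift i k) = tnth t k.
Proof. by rewrite tnth_mktuple liftK. Qed.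

Lemma tnth_tcons n x (t : n.-tuple R) k : tnth (tcons x t) (lift ord0 k) = tnth t k.
Proof. by rewrite tnthS. Qed.

Lemma tins0 n x (t : n.-tuple R) : tins ord0 x t = tcons x t.
Proof.
apply/eq_from_tnth => j; case: (unliftP ord0 j) => [k|] ->.
  by rewrite tnth_tins_lift tnth_tcons.
by rewrite tnth_tins.
Qed.

Lemma tinsS n (i : 'I_n.+1) y x (t : n.-tuple R) :
  tins (lift ord0 i) y (tcons x t) = tcons x (tins i y t).
Proof.
apply/eq_from_tnth => j; case: (unliftP ord0 j) => [k|] ->.
  rewrite tnth_tcons; case: (unliftP i k) => [l|] ->; last by rewrite !tnth_tins.
  rewrite tnth_tins_lift [X in tnth _ X](_ : _ = lift (lift ord0 i) (lift ord0 l)).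
    by rewrite tnth_tins_lift tnth_tcons.
  by apply: val_inj => /=; rewrite /bump /= !add1n ltnS; case: leqP.
rewrite [X in tnth _ X = _](_ : ord0 = lift (lift ord0 i) ord0); last exact: val_inj.
by rewrite tnth_tins_lift.
Qed.

Lemma measurable_tins n d (S : measurableType d) i (f : S -> T) (g : S -> n.-tuple T) :
  measurable_fun setT f -> measurable_fun setT g ->
  measurable_fun setT (fun s => tins i (f s) (g s) : n.+1.-tuple T).
Proof.
move=> mf mg; apply/measurable_fun_tnthP => j.
case: (unliftP i j) => [k|] ->.
  rewrite (_ : _ \o _ = (fun t => tnth t k) \o g).
    by apply: measurableT_comp => //; exact: measurable_tnth.
  by apply/funext => s /=; rewrite tnth_tins_lift.
rewrite (_ : _ \o _ = f) //.
by apply/funext => s /=; rewrite tnth_tins.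
Qed.

Lemma lebesgue_vol_ins n (i : 'I_n.+1) (A : set (n.+1.-tuple T)) : measurable A ->
  lebesgue_vol A = \int[leb]_x lebesgue_vol [set t : n.-tuple R | A (tins i x t)].
Proof.
have base m (B : set (m.+1.-tuple T)) :
    lebesgue_vol B = \int[leb]_x lebesgue_vol [set t : m.-tuple R | B (tins ord0 x t)].
  by apply: eq_integral => x _; congr lebesgue_vol; apply/funext => t /=; rewrite tins0.
elim: n i A => [|n IH] i A mA; first by rewrite ord1.
case: (unliftP ord0 i) => [k|] ->; last exact: base.
pose f (p : T * T) := lebesgue_vol [set t : n.-tuple R | A (tcons p.1 (tins k p.2 t))].
transitivity (\int[leb]_x \int[leb]_y f (x, y)).
  apply: eq_integral => x _; apply: (IH k [set t | A (tcons x t)]).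
  exact: (@measurable_slice _ n.+1 A).
rewrite fubini_tonelli.
- apply: eq_integral => x _; apply: eq_integral => y _ /=.
  by congr lebesgue_vol; apply/funext => t /=; rewrite -tinsS.
- apply: (@measurable_section_vol _ n _ _
    [set q : T * T * n.-tuple T | A (tcons q.1.1 (tins k q.1.2 q.2))]).
  apply: (@preimage_measurable _ _ _ _
    (fun q : T * T * n.-tuple T => tcons q.1.1 (tins k q.1.2 q.2))) => //.
  apply: measurable_tcons.
    by apply: (measurableT_comp measurable_fst) => //; exact: measurable_fst.
  apply: measurable_tins => //.
  by apply: (measurableT_comp measurable_snd) => //; exact: measurable_fst.
- by move=> p; exact: lebesgue_vol_ge0.
Qed.

Lemma integral_affine (g : T -> \bar R) (c l : R) : (0 < l)%R ->
  measurable_fun setT g -> (forall x, 0 <= g x) ->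
  \int[leb]_x g (c + l * x)%R = (l^-1)%:E * \int[leb]_x g x.
Proof.
move=> l0 mg g0.
pose phi (x : T) : T := (c + l * x)%R.
have mphi : measurable_fun setT phi.
  by apply: measurable_funD => //; apply: measurable_funM.
have preE (a b : R) : phi @^-1` `]a, b] = `]((a - c) / l)%R, ((b - c) / l)%R]%classic.
  apply/seteqP; split => x /=; rewrite /phi !in_itv /=;
    by rewrite ltr_pdivrMr // ler_pdivlMr // [(x * l)%R]mulrC ltrBlDl lerBrDl.
pose k := NngNum (ltW l0).
have scale A : measurable A -> pushforward (mscale k leb) (phi : _ -> measurableTypeR R) A = leb A.
  move=> mA; apply/esym/lebesgue_measure_unique => // _ [[a b] _ <-] /=.
  rewrite /pushforward preE /mscale /= !lebesgue_measure_itv /= !lte_fin.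
  rewrite ltr_pM2r ?invr_gt0 // ltrD2r; case: ifP => _; last by rewrite mule0.
  by rewrite -!EFinB -EFinM; congr _%:E; field; rewrite gt_eqF.
have -> : \int[leb]_x g x = \int[pushforward (mscale k leb) (phi : _ -> measurableTypeR R)]_x g x.
  by apply: eq_measure_integral => A mA _; exact/esym/scale.
have -> : \int[pushforward (mscale k leb) (phi : _ -> measurableTypeR R)]_x g x =
    \int[mscale k leb]_x g (phi x).
  apply: (@ge0_integral_pushforward _ _ (measurableTypeR R) (measurableTypeR R) R phi mphi
    (mscale k leb) setT g) => //.
rewrite ge0_integral_mscale //.
  by rewrite muleA -EFinM mulVf ?gt_eqF // mul1e.
exact: measurableT_comp.
Qed.

Definition taff n (c : n.-tuple R) (l : R) (t : n.-tuple R) : n.-tuple R :=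
  [tuple tnth c j + l * tnth t j | j < n]%R.

Lemma taff_cons n c0 x (c : n.-tuple R) (l : R) (t : n.-tuple R) :
  taff (tcons c0 c) l (tcons x t) = tcons (c0 + l * x) (taff c l t).
Proof.
apply/eq_from_tnth => j; case: (unliftP ord0 j) => [k|] ->.
  by rewrite tnth_tcons !tnth_mktuple !tnth_tcons.
by rewrite !tnth_mktuple.
Qed.

Lemma lebesgue_vol_affine n (A : set (n.-tuple T)) (c : n.-tuple R) (l : R) : measurable A -> (0 < l)%R ->
  lebesgue_vol [set t | A (taff c l t)] = (l ^- n)%:E * lebesgue_vol A.
Proof.
move=> + l0; elim: n A c => [|n IH] A c mA.
  rewrite expr0 invr1 mul1e (_ : [set t | A (taff c l t)] = A) //.
  by apply/funext => t /=; rewrite [t]tuple0 [taff _ _ _]tuple0.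
rewrite /= (tuple_eta c).
pose g (x : T) := lebesgue_vol [set t : n.-tuple R | A (tcons x t)].
have mg : measurable_fun setT g by exact: (@measurable_slice_vol _ n A).
have ma : measurable_fun setT (fun x : T => thead c + l * x : T)%R.
  by apply: measurable_funD => //; apply: measurable_funM.
transitivity (\int[leb]_x ((l ^- n)%:E * g (thead c + l * x)%R)).
  apply: eq_integral => x _; rewrite -(IH _ [tuple of behead c]); last first.
    exact: (@measurable_slice _ n A).
  by congr lebesgue_vol; apply/funext => t /=; rewrite -taff_cons.
rewrite ge0_integralZl //; last 3 first.
- exact: (measurableT_comp mg ma).
- by move=> x _; exact: lebesgue_vol_ge0.
- by rewrite lee_fin invr_ge0 exprn_ge0 // ltW.
rewrite integral_affine //; last by move=> x; exact: lebesgue_vol_ge0.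
by rewrite muleA -EFinM -invfM -exprSr.
Qed.

End Ins.

Section ConeVolume.
Variable R : realType.
Local Notation leb := (@lebesgue_measure R).
Local Notation T := (Real.sort R).
Local Open Scope ereal_scope.

Lemma lebesgue_vol0 n : lebesgue_vol (set0 : set (n.-tuple R)) = 0.
Proof.
elim: n => [|n IH] /=; first by rewrite indic0.
by under eq_integral do rewrite IH; rewrite integral0.
Qed.

Lemma integral_Xn01 n : \int[leb]_(x in `[0%R, 1%R]) (x ^+ n)%:E = (n.+1%:R^-1)%:E.
Proof.
pose F (x : R) : R := (n.+1%:R^-1 * x ^+ n.+1)%R.
have dF (x : R) : is_derive x 1%R F (x ^+ n)%R.
  rewrite (_ : F = n.+1%:R^-1 *: ((id : R -> R) ^+ n.+1))%R; last first.
    by apply/funext => y; rewrite /F !fctE.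
  apply: is_derive_eq.
  by rewrite /= scalerA mulrA mulVf ?pnatr_eq0 // mul1r [_ *: _]mulr1.
have cF (x : R) : {for x, continuous F}.
  exact/differentiable_continuous/derivable1_diffP.
rewrite (@continuous_FTC2 _ _ F) //.
- by rewrite /F expr0n expr1n mulr0 mulr1 sube0.
- by apply: continuous_subspaceT => x; exact: exprn_continuous.
- split => [x _||] //.
  + exact: cvg_at_right_filter (cF _).
  + exact: cvg_at_left_filter (cF _).
- by move=> x _; rewrite derive1E derive_val.
Qed.

Lemma lebesgue_vol_cone n (A : set (n.+1.-tuple T)) (B : set (n.-tuple T)) (i : 'I_n.+1)
    (c : n.-tuple R) (w z b : R) :
  measurable A -> measurable B -> (w < z)%R -> lebesgue_vol B = b%:E ->
  (forall x, x != w -> x != z -> [set t | A (tins i x t)] =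
    if (w < x < z)%R then let l := ((x - w) / (z - w))%R in
      [set t | B [tuple tnth c j + l^-1 * (tnth t j - tnth c j) | j < n]%R]
    else set0) ->
  lebesgue_vol A = ((z - w) * n.+1%:R^-1 * b)%:E.
Proof.
move=> mA mB wz Bb slice.
have zw0 : (0 < z - w)%R by rewrite subr_gt0.
have b0 : (0 <= b)%R by rewrite -lee_fin -Bb lebesgue_vol_ge0.
rewrite (lebesgue_vol_ins i) //.
pose h (y : T) := (y ^+ n * \1_`[0%R, 1%R] y)%:E : \bar R.
have mh : measurable_fun setT h.
  apply/measurable_EFinP; apply: measurable_funM; first exact: exprn_measurable.
  exact: measurable_indic.
have h0 y : 0 <= h y.
  rewrite lee_fin indicE; case: (boolP (y \in _)) => [|_]; last by rewrite mulr0.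
  by rewrite inE /= in_itv /= => /andP[y0 _]; rewrite mulr1 exprn_ge0.
have ma : measurable_fun setT (fun x : T => - w / (z - w) + (z - w)^-1 * x : T)%R.
  by apply: measurable_funD => //; apply: measurable_funM.
have mha := measurableT_comp mh ma.
have mF : measurable_fun setT
    ((fun x => lebesgue_vol [set t : n.-tuple R | A (tins i x t)]) : T -> \bar R).
  apply: (@measurable_section_vol _ n _ T [set q : T * n.-tuple T | A (tins i q.1 q.2)]).
  apply: (@preimage_measurable _ _ _ _ (fun q : T * n.-tuple T => tins i q.1 q.2)) => //.
  exact: measurable_tins.
transitivity (\int[leb]_x (b%:E * h (- w / (z - w) + (z - w)^-1 * x)%R)).
  apply: ge0_ae_eq_integral => //.
  - by apply: emeasurable_funM => //; exact: measurable_cst.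
  - by move=> x _; exact: lebesgue_vol_ge0.
  - by move=> x _; rewrite mule_ge0.
  exists ([set w] `|` [set z]); split.
  - by apply: measurableU.
  - by apply: countable_lebesgue_measure0; apply: finite_set_countable.
  move=> x /= /not_implyP[_]; apply: contra_notP => /not_orP[/eqP xw /eqP xz].
  rewrite slice //.
  have -> : (- w / (z - w) + (z - w)^-1 * x = (x - w) / (z - w))%R by ring.
  case: ifPn => [/andP[wx xz']|wxz].
    set l := ((x - w) / (z - w))%R.
    have l0 : (0 < l)%R by rewrite divr_gt0 // subr_gt0.
    pose c' := [tuple tnth c j - l^-1 * tnth c j | j < n]%R.
    rewrite [X in lebesgue_vol X](_ : _ = [set t | B (taff c' l^-1 t)]).
      rewrite lebesgue_vol_affine ?invr_gt0 // exprVn invrK Bb muleC /h indicE mem_set ?mulr1 //=.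
      by rewrite in_itv /= (ltW l0) ler_pdivrMr // mul1r lerB // ltW.
    apply/funext => t /=; congr B; apply/eq_from_tnth => j; rewrite !tnth_mktuple; ring.
  rewrite lebesgue_vol0 /h indicE memNset ?mulr0 ?mule0 //=.
  rewrite in_itv /= => /andP[]; rewrite ler_pdivlMr // mul0r subr_ge0 ler_pdivrMr // mul1r lerD2r => wx xz'.
  by move/negP: wxz; apply; rewrite !lt_neqAle eq_sym xw wx xz xz'.
rewrite ge0_integralZl //.
rewrite (@integral_affine _ h) ?invr_gt0 // invrK.
rewrite (_ : \int[leb]_x h x = \int[leb]_(x in `[0%R, 1%R]) (x ^+ n)%:E); last first.
  rewrite [RHS]integral_mkcond; apply: eq_integral => x _.
  by rewrite /h patchE indicE; case: (_ \in _); rewrite ?mulr1 ?mulr0.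
by rewrite integral_Xn01 -!EFinM mulrC.
Qed.

End ConeVolume.

(** * A Bochner argument *)

Section Hyperbolic.
Variable R : realFieldType.

Lemma reverse_cs (a b c t : R) : 0 < a -> c - 2 * t * b + t ^+ 2 * a <= 0 -> a * c <= b ^+ 2.
Proof.
move=> a0 h; have : a * (c - 2 * t * b + t ^+ 2 * a) <= 0 by rewrite pmulr_rle0.
have := sqr_ge0 (t * a - b); nra.
Qed.

Section Bochner.
Variables (n : nat) (m : 'I_n -> 'I_n -> R) (v : 'I_n -> R).
Implicit Types (x y f : 'I_n -> R).

Let b y i := \sum_j m i j * y j.
Let beta x y := \sum_i x i * b y i.

Hypotheses (m_sym : forall i j, m i j = m j i)
  (m_ge0 : forall i j, i != j -> 0 <= m i j)
  (v_gt0 : forall i, 0 < v i)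
  (bv_gt0 : forall i, 0 < b v i)
  (m_conn : forall f, (forall i j, i != j -> 0 < m i j -> f i = f j) -> forall i j, f i = f j)
  (bochner : forall y, beta y y <= \sum_i v i * b y i ^+ 2 / b v i).

Let p i := b v i / v i.
Let s x y := \sum_i p i * x i * y i.
Let c x y := s x y - beta x y.
Let C x i := x i - v i * b x i / b v i.

Let v_neq0 i : v i != 0. Proof. by rewrite gt_eqF. Qed.
Let bv_neq0 i : b v i != 0. Proof. by rewrite gt_eqF. Qed.
Let p_gt0 i : 0 < p i. Proof. by rewrite divr_gt0. Qed.

Let cE y : c y y = 2^-1 * \sum_i \sum_j m i j * v i * v j * (y i / v i - y j / v j) ^+ 2.
Proof.
pose W i j := m i j * v i * v j; pose u i := y i / v i.
have W_sym i j : W i j = W j i by rewrite /W m_sym; ring.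
have sE : s y y = \sum_i \sum_j W i j * u i ^+ 2.
  apply: eq_bigr => i _; rewrite /p /b 2!mulr_suml !mulr_suml.
  by apply: eq_bigr => j _; rewrite /W /u; field.
have sE' : s y y = \sum_i \sum_j W i j * u j ^+ 2.
  rewrite sE exchange_big; apply: eq_bigr => i _; apply: eq_bigr => j _.
  by rewrite W_sym.
have bE : beta y y = \sum_i \sum_j W i j * (u i * u j).
  apply: eq_bigr => i _; rewrite /b mulr_sumr.
  by apply: eq_bigr => j _; rewrite /W /u; field; rewrite !v_neq0.
have -> : c y y = 2^-1 * (s y y + s y y - 2 * beta y y) by rewrite /c; field.
rewrite {1}sE sE' bE mulr_sumr -big_split -sumrB /=; congr (_ * _).
apply: eq_bigr => i _; rewrite mulr_sumr -big_split -sumrB /=.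
by apply: eq_bigr => j _; rewrite -/(W i j) -/(u i) -/(u j); ring.
Qed.

Let term_ge0 y i j : 0 <= m i j * v i * v j * (y i / v i - y j / v j) ^+ 2.
Proof.
have [<-|ij] := eqVneq i j; first by rewrite subrr expr0n mulr0.
by rewrite mulr_ge0 ?sqr_ge0 // !mulr_ge0 ?m_ge0 // ltW.
Qed.

Let c_ge0 y : 0 <= c y y.
Proof. by rewrite cE mulr_ge0 ?invr_ge0 ?ler0n // !sumr_ge0 // => i _; exact: sumr_ge0. Qed.

Let c_eq0 y : c y y = 0 -> forall i j, y i / v i = y j / v j.
Proof.
move=> /eqP; rewrite cE mulf_eq0 invr_eq0 pnatr_eq0 /= => y0.
apply: (m_conn (f := fun i => y i / v i)) => i j ij mij.
rewrite psumr_eq0 in y0; last by move=> k _; exact: sumr_ge0.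
have /allP/(_ i (mem_index_enum i)) /= := y0.
rewrite psumr_eq0 => [|k _]; last exact: term_ge0.
move=> /allP/(_ j (mem_index_enum j)) /=.
by rewrite !mulf_eq0 (gt_eqF mij) !(negPf (v_neq0 _)) /= orbb subr_eq0 => /eqP ->.
Qed.

Let betaC x y : beta x y = beta y x.
Proof.
rewrite /beta /b; under eq_bigr do rewrite mulr_sumr.
rewrite exchange_big; apply: eq_bigr => i _; rewrite mulr_sumr; apply: eq_bigr => j _.
by rewrite m_sym; ring.
Qed.

Let s_symm x y : s x y = s y x.
Proof. by apply: eq_bigr => i _; ring. Qed.

Let sC x y : s (C x) y = c x y.
Proof.
rewrite /c betaC /s /beta -sumrB; apply: eq_bigr => i _.
by rewrite /C /p; field; rewrite v_neq0 bv_neq0.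
Qed.

Let Cv i : C v i = 0.
Proof. by rewrite /C; field. Qed.

Let sCv x : s (C x) v = 0.
Proof.
rewrite sC /c s_symm betaC -/(c v x) -sC.
by rewrite /s big1 // => i _; rewrite Cv mulr0 mul0r.
Qed.

Let svv_gt0 (i0 : 'I_n) : 0 < s v v.
Proof.
have pos i : 0 < p i * v i * v i by apply: mulr_gt0 => //; apply: mulr_gt0.
by rewrite /s (bigD1 i0) //=; apply: ltr_pwDl => //; apply: sumr_ge0 => i _; rewrite ltW.
Qed.

Let C_le x : s (C x) x <= s (C x) (C x).
Proof.
rewrite -subr_ge0 (_ : _ - _ = \sum_i v i * b x i ^+ 2 / b v i - beta x x) ?subr_ge0 //.
rewrite /s /beta -!sumrB; apply: eq_bigr => i _.
by rewrite /C /p; field; rewrite v_neq0 bv_neq0.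
Qed.

(* C + <., v> v is injective because C is positive off the line of v. *)
Let C_surj y : s y v = 0 -> exists x, forall i, C x i = y i.
Proof.
move=> yv.
pose A := \matrix_(i, j) ((i == j)%:R - v i * m i j / b v i + v i * (p j * v j)) : 'M[R]_n.
pose D x i := C x i + s x v * v i.
have AD (x : 'I_n -> R) i : (A *m \col_j x j) i 0 = D x i.
  rewrite mxE /D /C /s [b x i]/b mulr_suml mulr_sumr mulr_suml.
  rewrite [X in X - _](_ : _ = \sum_j (i == j)%:R * x j); last first.
    by rewrite (bigD1 i) //= eqxx mul1r big1 ?addr0 // => j; rewrite eq_sym => /negPf ->; rewrite mul0r.
  rewrite -sumrB -big_split; apply: eq_bigr => j _.
  by rewrite /A !mxE /=; ring.
have sD x : s (D x) v = s x v * s v v.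
  transitivity (s (C x) v + s x v * s v v); last by rewrite sCv add0r.
  rewrite [s v v]/s mulr_sumr [s (C x) v]/s -big_split; apply: eq_bigr => j _.
  by rewrite /D /=; ring.
have Dinj x : (forall i, D x i = 0) -> forall i, x i = 0.
  move=> Dx i; have svv := svv_gt0 i.
  have : s (D x) v = 0 by rewrite /s big1 // => j _; rewrite Dx mulr0 mul0r.
  rewrite sD => /eqP; rewrite mulf_eq0 (gt_eqF svv) orbF => /eqP xv.
  have Cx j : C x j = 0 by have := Dx j; rewrite /D xv mul0r addr0.
  have /c_eq0 xc : c x x = 0 by rewrite -sC /s big1 // => j _; rewrite Cx mulr0 mul0r.
  have xE j : x j = x i / v i * v j by rewrite (xc i j) divfK.
  have : s x v = x i / v i * s v v.
    by rewrite /s mulr_sumr; apply: eq_bigr => j _; rewrite [in LHS]xE; ring.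
  rewrite xv => /esym/eqP; rewrite mulf_eq0 (gt_eqF svv) orbF mulf_eq0 invr_eq0.
  by rewrite (negPf (v_neq0 i)) orbF => /eqP.
have Au : A \in unitmx.
  rewrite -unitmx_tr unitmxE unitfE; apply/det0P => -[w w0 wA].
  move: w0; apply/negP; rewrite negbK; apply/eqP/rowP => j; rewrite mxE.
  apply: (Dinj (w 0)) => i; rewrite -AD.
  have -> : \col_j w 0 j = w^T by apply/colP => k; rewrite !mxE.
  by rewrite -[A]trmxK -trmx_mul wA !mxE.
pose x := fun i => (invmx A *m \col_j y j) i 0.
have Dx i : D x i = y i.
  rewrite -AD (_ : \col_j x j = invmx A *m \col_j y j); last by apply/colP => j; rewrite mxE.
  by rewrite mulmxA mulmxV // mul1mx mxE.
exists x => i; rewrite -Dx /D.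
have : s (D x) v = 0 by rewrite -yv; apply: eq_bigr => j _; rewrite Dx.
by rewrite sD => /eqP; rewrite mulf_eq0 (gt_eqF (svv_gt0 i)) orbF => /eqP ->; rewrite mul0r addr0.
Qed.

(* The operator C satisfies C >= 0 and C^2 >= C, hence C >= 1 on the orthogonal
   of its kernel. *)
Lemma bochner_hyperbolic y : beta y v = 0 -> beta y y <= 0.
Proof.
move=> yv; have syv : s y v = 0.
  by rewrite -yv; apply: eq_bigr => i _; rewrite /p; field.
have [x xE] := C_surj syv.
have sE z : s y z = c x z by rewrite -sC; apply: eq_bigr => i _; rewrite xE.
have := c_ge0 (fun i => x i - y i).
have -> : c (fun i => x i - y i) (fun i => x i - y i) = c x x - 2 * c x y + c y y.
  have cB u w z : c (fun i => u i - w i) z = c u z - c w z.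
    rewrite /c /s /beta -!sumrB; apply: eq_bigr => i _; ring.
  have cC u w : c u w = c w u by rewrite /c s_symm betaC.
  by rewrite !cB ![c _ (fun i => _ - _)]cC !cB (cC y x); ring.
have : c x x <= s y y.
  have := C_le x; rewrite sC => /le_trans; apply.
  by apply: ler_sum => i _; rewrite !xE.
rewrite -(sE y) /c; lra.
Qed.

End Bochner.
End Hyperbolic.

(** * Normal complexes of simplicial fans *)

Section Dot.
Variables (R : realType) (N : vectType R) (ip : {dot N for idfun}).

Lemma ipC u v : ip u v = ip v u.
Proof. by rewrite (hermC ip) expr0 mul1r. Qed.

Lemma ipDr u v w : ip u (v + w) = ip u v + ip u w.
Proof. exact: linearD. Qed.

Lemma ipZr a u v : ip u (a *: v) = a * ip u v.
Proof. by rewrite linearZ. Qed.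

Lemma ipDl u v w : ip (v + w) u = ip v u + ip w u.
Proof. by rewrite ipC ipDr !(ipC u). Qed.

Lemma ipZl a u v : ip (a *: v) u = a * ip v u.
Proof. by rewrite ipC ipZr ipC. Qed.

Lemma ipBl u v w : ip (v - w) u = ip v u - ip w u.
Proof. by rewrite -scaleN1r ipDl ipZl mulN1r. Qed.

Lemma ipBr u v w : ip u (v - w) = ip u v - ip u w.
Proof. by rewrite ipC ipBl !(ipC u). Qed.

Lemma ip0l u : ip 0 u = 0.
Proof. by rewrite -(scale0r 0) ipZl mul0r. Qed.

Lemma ip_suml (I : Type) (s : seq I) (P : pred I) (F : I -> N) u :
  ip (\sum_(i <- s | P i) F i) u = \sum_(i <- s | P i) ip (F i) u.
Proof.
by apply: (big_morph (fun v => ip v u)) => [v w|]; [exact: ipDl|exact: ip0l].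
Qed.

Lemma ip_sumr (I : Type) (s : seq I) (P : pred I) (F : I -> N) u :
  ip u (\sum_(i <- s | P i) F i) = \sum_(i <- s | P i) ip u (F i).
Proof. by rewrite ipC ip_suml; apply: eq_bigr => i _; rewrite ipC. Qed.

Lemma ip_gt0 u : u != 0 -> 0 < ip u u.
Proof. exact: neq0_dnorm_gt0. Qed.

Lemma ip_ge0 u : 0 <= ip u u.
Proof. by have [->|/ip_gt0/ltW//] := eqVneq u 0; rewrite ip0l. Qed.

Lemma ip_eq0 u : ip u u = 0 -> u = 0.
Proof. by have [//|/ip_gt0 + u0] := eqVneq u 0; rewrite u0 ltxx. Qed.

Lemma ip_le0 u : ip u u <= 0 -> u = 0.
Proof. by move=> u0; apply: ip_eq0; apply/le_anti; rewrite u0 ip_ge0. Qed.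

End Dot.

Section Simplicial.
Variables (R : realType) (N : vectType R) (Sigma : marked_fan N).
Variable ip : {dot N for idfun}.

Definition simplicial_fan :=
  (forall s t : {set ray Sigma}, s \in cones Sigma -> t \subset s -> t \in cones Sigma) /\
  (forall (s : {set ray Sigma}) (a : ray Sigma -> R), s \in cones Sigma ->
    \sum_(r in s) a r *: gen r = 0 -> forall r, r \in s -> a r = 0).

Hypothesis simp : simplicial_fan.
Let cones_sub := simp.1.
Let cones_free := simp.2.

Implicit Types (s t : {set ray Sigma}) (z : ray Sigma -> R) (r : ray Sigma) (v w : N).
Local Notation g := (@gen R N Sigma).
Local Notation cs := (@cone_span R N Sigma).
Local Notation wv := (w_ ip).

Lemma gen_span s r : r \in s -> g r \in cs s.
Proof. by move=> rs; apply: memv_span; apply: map_f; rewrite mem_enum. Qed.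

Lemma span_sum s (a : ray Sigma -> R) : \sum_(r in s) a r *: g r \in cs s.
Proof. by apply: memv_suml => r rs; rewrite memvZ ?gen_span. Qed.

Lemma spanP s v : reflect (exists a, v = \sum_(r in s) a r *: g r) (v \in cs s).
Proof.
apply: (iffP idP) => [|[a ->]]; last exact: span_sum.
rewrite /cone_span span_def big_map big_enum /= => /memv_sumP[vs vsg ->].
have [a aP] : exists a : ray Sigma -> R, forall r, r \in s -> vs r = a r *: g r.
  suff /choice[a aP] : forall r, exists k : R, r \in s -> vs r = k *: g r by exists a.
  move=> r; have [rs|_] := boolP (r \in s); last by exists 0.
  by have /vlineP[k ->] := vsg r rs; exists k.
by exists a; apply: eq_bigr.
Qed.

Lemma ortho_span s v w : (forall r, r \in s -> ip v (g r) = 0) -> w \in cs s -> ip v w = 0.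
Proof.
move=> vs /spanP[a ->]; rewrite ip_sumr big1 // => r rs.
by rewrite ipZr vs // mulr0.
Qed.

Lemma spanS s t v : s \subset t -> v \in cs s -> v \in cs t.
Proof.
move=> st /spanP[a ->]; apply: memv_suml => r rs.
by rewrite memvZ // gen_span // (fintype.subsetP st).
Qed.

Lemma gen_notin_span s r : (r |: s)%SET \in cones Sigma -> r \notin s -> g r \notin cs s.
Proof.
move=> rsC rs; apply/negP => /spanP[a gE].
have : \sum_(k in (r |: s)%SET) (if k == r then -1 else a k) *: g k = 0.
  rewrite big_setU1 //= eqxx scaleN1r [X in _ + X](_ : _ = g r) ?addNr //.
  rewrite [in RHS]gE; apply: eq_bigr => k ks; case: eqP => // kr.
  by move: rs; rewrite -kr ks.
move/(cones_free rsC)/(_ r); rewrite eqxx finset.setU11 => /(_ isT)/eqP.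
by rewrite oppr_eq0 oner_eq0.
Qed.

Lemma gram_ex s z : s \in cones Sigma ->
  exists w, w \in cs s /\ forall r, r \in s -> ip w (g r) = z r.
Proof.
elim: {s}_.+1 {-2}s (ltnSn #|s|) z => // n IH s + z sC; rewrite ltnS => sn.
have [->|[r rs]] := set_0Vmem s.
  by exists 0; split=> [|r]; rewrite ?mem0v // inE.
have rs' : r \notin (s :\ r)%SET by rewrite finset.setD11.
have sE := finset.setD1K rs.
have s'C : (s :\ r)%SET \in cones Sigma by apply: cones_sub sC _; exact: finset.subsetDl.
have s'n : (#|(s :\ r)%SET| < n)%N by apply: leq_trans sn; rewrite (cardsD1 r s) rs.
have [w' [w's w'z]] := IH _ s'n z s'C.
have [p [ps pz]] := IH _ s'n (fun k => ip (g r) (g k)) s'C.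
pose gp := g r - p.
have gp_orth k : k \in (s :\ r)%SET -> ip gp (g k) = 0 by move=> ks; rewrite ipBl pz ?subrr.
have gpr : ip gp (g r) = ip gp gp.
  by rewrite {3}/gp ipBr (ortho_span gp_orth ps) subr0.
have gp0 : ip gp gp != 0.
  apply: contraNneq (gen_notin_span _ rs') => [/ip_eq0/eqP|]; last by rewrite sE.
  by rewrite subr_eq0 => /eqP ->.
exists (w' + ((z r - ip w' (g r)) / ip gp gp) *: gp); split.
  by rewrite memvD // ?memvZ ?memvB ?gen_span // (spanS _ ps, spanS _ w's) // finset.subsetDl.
move=> k; rewrite -[in k \in _]sE ipDl ipZl in_setU1 => /predU1P[->|ks].
  by rewrite gpr mulfVK // addrC subrK.
by rewrite gp_orth // mulr0 addr0 w'z.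
Qed.

Lemma w_P s z : s \in cones Sigma ->
  wv s z \in cs s /\ forall r, r \in s -> ip (wv s z) (g r) = z r.
Proof. by move=> sC; rewrite /w_; case: xgetP => // w0; have [w /w0] := gram_ex z sC. Qed.

Lemma w_span s z : s \in cones Sigma -> wv s z \in cs s.
Proof. by case/(w_P z). Qed.

Lemma ip_w s z r : s \in cones Sigma -> r \in s -> ip (wv s z) (g r) = z r.
Proof. by case/(w_P z) => _; apply. Qed.

Lemma w_uniq s z v : s \in cones Sigma -> v \in cs s ->
  (forall r, r \in s -> ip v (g r) = z r) -> v = wv s z.
Proof.
move=> sC vs vz; apply/eqP; rewrite -subr_eq0; apply/eqP/(ip_eq0 (ip := ip)).
apply: (ortho_span (s := s)); last by rewrite memvB ?w_span.
by move=> r rs; rewrite ipBl vz // ip_w // subrr.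
Qed.

Lemma w_lin s a z b z' : s \in cones Sigma ->
  wv s (fun r => a * z r + b * z' r) = a *: wv s z + b *: wv s z'.
Proof.
move=> sC; apply/esym/w_uniq => // [|r rs].
  by rewrite memvD ?memvZ ?w_span.
by rewrite ipDl !ipZl !ip_w.
Qed.

Lemma w_eq s z z' : s \in cones Sigma -> {in s, z =1 z'} -> wv s z = wv s z'.
Proof. by move=> sC zz'; apply: w_uniq; rewrite ?w_span // => r rs; rewrite ip_w // zz'. Qed.

Definition coef s r v : R := ip v (dual_basis ip s r).

Lemma coef_sum s (a : ray Sigma -> R) r : s \in cones Sigma -> r \in s ->
  coef s r (\sum_(k in s) a k *: g k) = a r.
Proof.
move=> sC rs; rewrite /coef ip_suml (bigD1 r) //= big1 => [|k /andP[ks kr]].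
  by rewrite ipZl ipC ip_w // eqxx mulr1 addr0.
by rewrite ipZl ipC ip_w // (negPf kr) mulr0.
Qed.

Lemma sum_coef s v : s \in cones Sigma -> v \in cs s -> v = \sum_(r in s) coef s r v *: g r.
Proof.
by move=> sC /spanP[a ->]; apply: eq_bigr => r rs; rewrite coef_sum.
Qed.

Lemma coefD s r a v b w : coef s r (a *: v + b *: w) = a * coef s r v + b * coef s r w.
Proof. by rewrite /coef ipDl !ipZl. Qed.

Lemma coneP s v : s \in cones Sigma ->
  cone s v <-> v \in cs s /\ forall r, r \in s -> 0 <= coef s r v.
Proof.
move=> sC; split=> [[a a0 <-]|[vs v0]].
  by split=> [|r rs]; [exact: span_sum|rewrite coef_sum].
exists (fun r => if r \in s then coef s r v else 0) => [r /=|].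
  by case: ifP => // /v0.
by rewrite [RHS](sum_coef sC vs); apply: eq_bigr => r ->.
Qed.

Definition cubical z := forall s, s \in cones Sigma ->
  forall r, r \in s -> 0 < coef s r (wv s z).

Lemma Cub_cubical z : Cub Sigma ip z -> cubical z.
Proof.
move=> zC s sC r rs; have [ws [e e0 ball]] := zC s sC.
pose k := e / 2 / (1 + ip (g r) (g r)).
have d0 : 0 < 1 + ip (g r) (g r) by rewrite ltr_pwDl ?ip_ge0.
have k0 : 0 < k by rewrite !divr_gt0.
have := ball (wv s z - k *: g r); rewrite memvB ?memvZ ?gen_span // => /(_ isT).
rewrite addrAC subrr add0r -scaleNr ipZl ipZr mulrA mulrNN.
have -> : k * k * ip (g r) (g r) < e ^+ 2.
  have -> : k * k = e ^+ 2 / 4 / (1 + ip (g r) (g r)) ^+ 2.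
    by rewrite /k; field; rewrite gt_eqF.
  rewrite mulrAC ltr_pdivrMr ?exprn_gt0 // -mulrA ltr_pM2l ?exprn_gt0 //.
  have := ip_ge0 ip (g r); nra.
move=> /(_ isT)/(coneP _ sC)[_ /(_ r rs)].
rewrite scaleNr -[wv s z]scale1r -scaleNr coefD mul1r scale1r.
rewrite (_ : coef s r (g r) = 1).
  by move=> ?; lra.
by rewrite /coef ipC ip_w // eqxx.
Qed.

(* Up to the norm of the projection [gperp t r] of g r, this is the distance from
   w_t(z) to the hyperplane of the constraint r inside the flat where the
   constraints of t are tight. *)
Definition zst t z r := z r - ip (wv t z) (g r).

Definition gperp t r := g r - wv t (fun k => ip (g r) (g k)).

Definition zcoef t r k := ip (gperp t r) (g k) / ip (gperp t r) (gperp t r).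

Lemma gperp_orth t r k : t \in cones Sigma -> k \in t -> ip (gperp t r) (g k) = 0.
Proof. by move=> tC kt; rewrite ipBl ip_w // subrr. Qed.

Lemma gperp_span t r v : t \in cones Sigma -> v \in cs t -> ip (gperp t r) v = 0.
Proof. by move=> tC; apply: ortho_span => k kt; rewrite gperp_orth. Qed.

Lemma gperp_gt0 t r : (r |: t)%SET \in cones Sigma -> r \notin t ->
  0 < ip (gperp t r) (gperp t r).
Proof.
move=> rtC rt; have tC : t \in cones Sigma by apply: cones_sub rtC _; exact: finset.subsetUr.
apply: ip_gt0; apply: contra (gen_notin_span rtC rt); rewrite subr_eq0 => /eqP ->.
exact: w_span.
Qed.

Lemma ip_gperp t r : t \in cones Sigma -> ip (gperp t r) (g r) = ip (gperp t r) (gperp t r).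
Proof. by move=> tC; rewrite {3}/gperp ipBr (gperp_span r tC (w_span _ tC)) subr0. Qed.

Lemma w_setU1 t z r : (r |: t)%SET \in cones Sigma -> r \notin t ->
  wv (r |: t)%SET z = wv t z + (zst t z r / ip (gperp t r) (gperp t r)) *: gperp t r.
Proof.
move=> rtC rt; have tC : t \in cones Sigma by apply: cones_sub rtC _; exact: finset.subsetUr.
have trt : t \subset (r |: t)%SET by exact: finset.subsetUr.
apply/esym/w_uniq => // [|k].
  by rewrite memvD ?memvZ ?memvB ?gen_span ?finset.setU11 // (spanS trt) ?w_span.
rewrite in_setU1 ipDl ipZl => /predU1P[->|kt].
  by rewrite ip_gperp // mulfVK ?gt_eqF ?gperp_gt0 // addrC subrK.
by rewrite gperp_orth // mulr0 addr0 ip_w.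
Qed.

Lemma zst_setU1 t z r k : (r |: t)%SET \in cones Sigma -> r \notin t ->
  zst (r |: t)%SET z k = zst t z k - zst t z r * zcoef t r k.
Proof. by move=> rtC rt; rewrite /zst w_setU1 // ipDl ipZl /zcoef /zst; ring. Qed.

Lemma zst_lin t a z b z' r : t \in cones Sigma ->
  zst t (fun k => a * z k + b * z' k) r = a * zst t z r + b * zst t z' r.
Proof. by move=> tC; rewrite /zst w_lin // ipDl !ipZl; ring. Qed.

Lemma zst_gt0 t z r : cubical z -> (r |: t)%SET \in cones Sigma -> r \notin t -> 0 < zst t z r.
Proof.
move=> zC rtC rt; have tC : t \in cones Sigma by apply: cones_sub rtC _; exact: finset.subsetUr.
have := zC _ rtC r (finset.setU11 _ _).
rewrite w_setU1 // -[wv t z]scale1r coefD mul1r.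
have [a wE] := spanP _ _ (w_span z tC).
have coef0 v : v \in cs t -> coef (r |: t)%SET r v = 0.
  move=> vt; rewrite /coef ipC; apply: (ortho_span (s := t)) => // k kt.
  rewrite ip_w ?in_setU1 ?kt ?orbT //.
  by case: eqP => // kr; move: rt; rewrite -kr kt.
rewrite coef0 ?w_span // add0r.
have -> : coef (r |: t)%SET r (gperp t r) = 1.
  rewrite /gperp -[X in X - _]scale1r -scaleN1r coefD (coef0 (wv _ _)) ?w_span //.
  by rewrite mulr0 addr0 mul1r /coef ipC ip_w ?finset.setU11 // eqxx.
by rewrite mulr1 pmulr_lgt0 // invr_gt0 gperp_gt0.
Qed.

Lemma ip_w_lt t z r : cubical z -> (r |: t)%SET \in cones Sigma -> r \notin t ->
  ip (wv t z) (g r) < z r.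
Proof. by move=> zC rtC rt; rewrite -subr_gt0 zst_gt0. Qed.

Definition convex_pred (K : set N) := forall u v a, K u -> K v -> 0 <= a <= 1 ->
  K (a *: u + (1 - a) *: v).

(* Peeling off the vertex [w_s] along the ray from [w_s] through [v] until it
   leaves the cone reduces to a facet of [s]. *)
Lemma face_hull z t s v (K : set N) : cubical z -> s \in cones Sigma -> t \subset s ->
  convex_pred K ->
  (forall t', t \subset t' -> t' \subset s -> K (wv t' z)) ->
  v \in cs s -> (forall r, r \in s -> r \notin t -> 0 <= coef s r v) ->
  (forall r, r \in t -> ip v (g r) = z r) ->
  (forall r, r \in s -> ip v (g r) <= z r) -> K v.
Proof.
move=> zC + + Kc.
elim: {s}_.+1 {-2}s (ltnSn #|s|) v => // n IH s + v sC ts Kw vs v0 vt vz; rewrite ltnS => sn.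
have [/existsP[r0 /andP[/andP[r0s r0t] vr0]]|] :=
  boolP [exists r, (r \in s) && (r \notin t) && (coef s r v < coef s r (wv s z))]; last first.
  rewrite negb_exists => /forallP vw.
  suff -> : v = wv s z by apply: Kw.
  apply/eqP; rewrite -subr_eq0; apply/eqP/(ip_le0 (ip := ip)).
  have vws : v - wv s z \in cs s by rewrite memvB ?w_span.
  rewrite {2}(sum_coef sC vws) ip_sumr; apply: sumr_le0 => r rs.
  rewrite ipZr ipBl (ip_w _ sC rs).
  have [rt|rt] := boolP (r \in t); first by rewrite vt // subrr mulr0.
  apply: mulr_ge0_le0; last by rewrite subr_le0 vz.
  rewrite -[v]scale1r -scaleN1r coefD mul1r mulN1r subr_ge0.
  by have := vw r; rewrite rs rt /= -leNgt.
pose q r := coef s r v / coef s r (wv s z).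
have [r /andP[/andP[rs rt] vr] rmin] := arg_minP q (i0 := r0)
  (P := fun r => (r \in s) && (r \notin t) && (coef s r v < coef s r (wv s z)))
  (introT andP (conj (introT andP (conj r0s r0t)) vr0)).
set mu := q r in rmin; have wpos k : k \in s -> 0 < coef s k (wv s z) by exact: zC.
have mu0 : 0 <= mu by rewrite divr_ge0 ?v0 // ltW ?wpos.
have mu1 : mu < 1 by rewrite ltr_pdivrMr ?wpos // mul1r.
have mu1' : 0 < 1 - mu by rewrite subr_gt0.
have mu1n : 1 - mu != 0 by rewrite gt_eqF.
pose v' := (1 - mu)^-1 *: v + (- (mu / (1 - mu))) *: wv s z.
have vE : v = mu *: wv s z + (1 - mu) *: v'.
  rewrite scalerDr !scalerA divff // scale1r mulrN mulrCA divff // mulr1.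
  by rewrite scaleNr addrCA subrr addr0.
have v's : v' \in cs s by rewrite memvD ?memvZ ?w_span.
have coefv' k : coef s k v' = (coef s k v - mu * coef s k (wv s z)) / (1 - mu).
  by rewrite coefD; field.
have coef_ge0 k : k \in s -> k \notin t -> 0 <= coef s k v'.
  move=> ks kt; rewrite coefv' divr_ge0 ?(ltW mu1') // subr_ge0 -ler_pdivlMr ?wpos //.
  have [kw|kw] := ltP (coef s k v) (coef s k (wv s z)); first by apply: rmin; rewrite ks kt.
  by rewrite (le_trans (ltW mu1)) // ler_pdivlMr ?wpos // mul1r.
have coefr : coef s r v' = 0.
  by rewrite coefv' /mu /q divfK ?gt_eqF ?wpos // subrr mul0r.
pose s' := (s :\ r)%SET.
have s'C : s' \in cones Sigma by apply: cones_sub sC _; exact: finset.subsetDl.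
have v'E : v' = \sum_(k in s') coef s k v' *: g k.
  rewrite [LHS](sum_coef sC v's) (bigD1 r) //= coefr scale0r add0r.
  by apply: eq_bigl => k; rewrite in_setD1 andbC.
have ts' : t \subset s'.
  by apply/fintype.subsetP => k kt; rewrite !inE (fintype.subsetP ts) // andbT; apply: contraNneq rt => <-.
have ipv' k : ip v' (g k) = (ip v (g k) - mu * ip (wv s z) (g k)) / (1 - mu).
  by rewrite ipDl !ipZl; field.
rewrite vE; apply: Kc; [|apply: (IH s') => //|by rewrite mu0 ltW].
- by apply: Kw.
- by apply: leq_trans sn; rewrite (cardsD1 r s) rs.
- by move=> t' tt' t's'; apply: Kw => //; apply: fintype.subset_trans t's' _; exact: finset.subsetDl.
- by rewrite v'E span_sum.
- move=> k; rewrite in_setD1 => /andP[kr ks] kt.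
  by rewrite v'E coef_sum ?in_setD1 ?kr // coef_ge0.
- move=> k kt; have ks := fintype.subsetP ts _ kt.
  by rewrite ipv' vt // ip_w //; field.
- move=> k; rewrite in_setD1 => /andP[kr ks].
  rewrite ipv' (ip_w _ sC ks) ler_pdivrMr // mulrBr mulr1 [z k * mu]mulrC.
  by rewrite lerB // vz.
Qed.

Lemma coef_suml s r (I : Type) (l : seq I) (P : pred I) (F : I -> N) :
  coef s r (\sum_(i <- l | P i) F i) = \sum_(i <- l | P i) coef s r (F i).
Proof. exact: ip_suml. Qed.

Lemma coef_notin t s r v : s \in cones Sigma -> t \subset s -> r \in s -> r \notin t ->
  v \in cs t -> coef s r v = 0.
Proof.
move=> sC ts rs rt vt; rewrite /coef ipC; apply: (ortho_span _ vt) => k kt.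
rewrite ip_w // ?(fintype.subsetP ts) //.
by case: eqP => // kr; move: rt; rewrite -kr kt.
Qed.

Lemma coef_sub t s r v : s \in cones Sigma -> t \subset s -> r \in t ->
  v \in cs t -> coef s r v = coef t r v.
Proof.
move=> sC ts rt /spanP[a ->]; have tC := cones_sub sC ts.
have E : \sum_(k in t) a k *: g k = \sum_(k in s) (if k \in t then a k else 0) *: g k.
  rewrite [RHS](big_setID t) /= (finset.setIidPr ts).
  rewrite [X in _ = _ + X]big1 ?addr0 => [|k]; first by apply: eq_bigr => k ->.
  by rewrite finset.in_setD => /andP[/negPf -> _]; rewrite scale0r.
by rewrite (coef_sum a tC rt) E coef_sum ?(fintype.subsetP ts) // rt.
Qed.

Lemma coef_w_ge0 t s z r : cubical z -> s \in cones Sigma -> t \subset s -> r \in s ->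
  0 <= coef s r (wv t z).
Proof.
move=> zC sC ts rs; have tC := cones_sub sC ts.
have [rt|rt] := boolP (r \in t); last by rewrite (coef_notin sC ts) ?w_span.
by rewrite (coef_sub sC ts) ?w_span // ltW // zC.
Qed.

Lemma ip_w_le t s z r : cubical z -> s \in cones Sigma -> t \subset s -> r \in s ->
  ip (wv t z) (g r) <= z r.
Proof.
move=> zC sC ts rs; have tC := cones_sub sC ts.
have [rt|rt] := boolP (r \in t); first by rewrite ip_w.
apply/ltW/ip_w_lt => //; apply: cones_sub sC _.
by rewrite finset.subUset finset.sub1set rs.
Qed.

Lemma cone_convex s : s \in cones Sigma -> convex_pred (cone s).
Proof.
move=> sC u v a /(coneP _ sC)[us u0] /(coneP _ sC)[vs v0] /andP[a0 a1].
apply/(coneP _ sC); split=> [|r rs]; first by rewrite memvD ?memvZ.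
by rewrite coefD addr_ge0 // mulr_ge0 ?u0 ?v0 ?subr_ge0.
Qed.

Lemma cone_w t s z : cubical z -> s \in cones Sigma -> t \subset s -> cone s (wv t z).
Proof.
move=> zC sC ts; apply/(coneP _ sC); split=> [|r rs]; last exact: coef_w_ge0.
by rewrite (spanS ts) // w_span // (cones_sub sC).
Qed.

Lemma P_w t s z : cubical z -> s \in cones Sigma -> t \subset s -> P_ ip s z (wv t z).
Proof. by move=> zC sC ts; split; [exact: cone_w|move=> r rs; exact: (ip_w_le zC sC)]. Qed.

Lemma P_convex s z : s \in cones Sigma -> convex_pred (P_ ip s z).
Proof.
move=> sC u v a [us uz] [vs vz] a01; split; first exact: cone_convex.
move=> r rs; rewrite ipDl !ipZl; case/andP: a01 => a0 a1.
have := uz r rs; have := vz r rs.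
by rewrite -subr_ge0 in a1; move=> /(ler_wpM2l a1) ? /(ler_wpM2l a0) ?; lra.
Qed.

Lemma P_hull s z v (K : set N) : cubical z -> s \in cones Sigma -> convex_pred K ->
  (forall t, t \subset s -> K (wv t z)) -> P_ ip s z v -> K v.
Proof.
move=> zC sC Kc Kw [/(coneP _ sC)[vs v0] vz].
apply: (face_hull zC sC (finset.sub0set s) Kc) => // [t _|r|r]; first exact: Kw.
  by move=> rs _; exact: v0.
by rewrite inE.
Qed.

Lemma convex_hull_convex (I : finType) (p : I -> N) : convex_pred (convex_hull p).
Proof.
move=> _ _ c [a [a0 a1 ->]] [b [b0 b1 ->]] /andP[c0 c1].
exists (fun i => c * a i + (1 - c) * b i); split=> [i||].
- by rewrite addr_ge0 // mulr_ge0 // subr_ge0.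
- by rewrite big_split /= -!mulr_sumr a1 b1; ring.
- rewrite !scaler_sumr -big_split /=; apply: eq_bigr => i _.
  by rewrite [RHS]scalerDl !scalerA.
Qed.

Lemma polytope_P s z : cubical z -> s \in cones Sigma -> polytope (cs s) (P_ ip s z).
Proof.
move=> zC sC; exists {set ray Sigma}, finset.set0, (fun t => wv (t :&: s)%SET z).
have tC t : (t :&: s)%SET \in cones Sigma by apply: cones_sub sC _; exact: finset.subsetIr.
have ts t : (t :&: s)%SET \subset s by exact: finset.subsetIr.
split=> [t|]; first by rewrite (spanS (ts t)) ?w_span.
apply/seteqP; split=> v.
  apply: P_hull => // [|t tS]; first exact: convex_hull_convex.
  exists (fun t' => (t' == t)%:R); split=> [t'||]; first exact: ler0n.
    by rewrite (bigD1 t) //= eqxx big1 ?addr0 // => k /negPf ->.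
  rewrite (bigD1 t) //= eqxx big1 ?addr0 // => [|k /negPf ->]; last by rewrite scale0r.
  by rewrite scale1r (finset.setIidPl tS).
case=> a [a0 a1 ->]; split.
  apply/(coneP _ sC); split=> [|r rs].
    by apply: memv_suml => t _; rewrite memvZ // (spanS (ts t)) ?w_span.
  rewrite coef_suml sumr_ge0 // => t _.
  by rewrite /coef ipZl mulr_ge0 //; exact: coef_w_ge0.
move=> r rs; rewrite ip_suml -[z r]mul1r -a1 mulr_suml; apply: ler_sum => t _.
by rewrite ipZl ler_wpM2l // (ip_w_le zC sC).
Qed.

Lemma w_sum s (I : finType) (z : I -> ray Sigma -> R) (S : {set I}) : s \in cones Sigma ->
  wv s (fun r => \sum_(i in S) z i r) = \sum_(i in S) wv s (z i).
Proof.
move=> sC; apply/esym/w_uniq => // [|r rs]; first by apply: memv_suml => i _; rewrite w_span.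
by rewrite ip_suml; apply: eq_bigr => i _; rewrite ip_w.
Qed.

Lemma cubical_sum d (z : 'I_d -> ray Sigma -> R) (S : {set 'I_d}) :
  (forall i, cubical (z i)) -> S != finset.set0 -> cubical (fun r => \sum_(i in S) z i r).
Proof.
move=> zC /set0Pn[i iS] s sC r rs; rewrite w_sum // coef_suml (bigD1 i) //=.
by rewrite ltr_pwDl ?zC // sumr_ge0 // => j _; rewrite ltW // zC.
Qed.

Lemma minkowski_sum_P s d (z : 'I_d -> ray Sigma -> R) (S : {set 'I_d}) :
  s \in cones Sigma -> (forall i, cubical (z i)) -> S != finset.set0 ->
  minkowski_sum (fun i => P_ ip s (z i)) S = P_ ip s (fun r => \sum_(i in S) z i r).
Proof.
move=> sC zC S0; apply/seteqP; split=> v; last first.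
  apply: P_hull => // [|_ _ a [x xP <-] [y yP <-] a01|t ts]; first exact: cubical_sum.
    exists (fun i => a *: x i + (1 - a) *: y i).
      by move=> i; apply: P_convex.
    by rewrite !scaler_sumr -big_split.
  exists (fun i => wv t (z i)); last by rewrite w_sum // (cones_sub sC).
  by move=> i; exact: P_w.
case=> x xP <-; split.
  apply/(coneP _ sC); split=> [|r rs].
    by apply: memv_suml => i _; have [/(coneP _ sC)[]] := xP i.
  rewrite coef_suml sumr_ge0 // => i _; by have [/(coneP _ sC)[_ +] _] := xP i; apply.
by move=> r rs; rewrite ip_suml ler_sum // => i _; by have [_] := xP i; apply.
Qed.

Fixpoint volc n s t z : R := if n is m.+1 then
  \sum_(r in s | r \notin t) zst t z r * volc m s (r |: t)%SET z else 1.

Section Face.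
Variables (s : {set ray Sigma}) (z : ray Sigma -> R).
Hypotheses (sC : s \in cones Sigma) (zC : cubical z).
Local Notation e := (dual_basis ip s).

Definition face_vec n t (rho : 'I_n -> ray Sigma) (x : n.-tuple R) : N :=
  \sum_(k in t) z k *: e k + \sum_i tnth x i *: e (rho i).

(* The face of P_s(z) on which the constraints of t are tight, in the dual
   coordinates indexed by rho; [b] tells which remaining constraints are closed.
   Allowing open constraints makes the decomposition below an exact partition. *)
Definition face n t (rho : 'I_n -> ray Sigma) (b : 'I_n -> bool) : set (n.-tuple R) :=
  [set x | (forall r, r \in s -> 0 <= coef s r (face_vec t rho x)) /\
           (forall i, tnth x i < z (rho i) ?<= if b i)].

Definition enumerates n t (rho : 'I_n -> ray Sigma) : Prop :=
  [/\ t \subset s, injective rho & forall r, (r \in s) && (r \notin t) = [exists i, rho i == r]].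

Lemma face_vec_span n t (rho : 'I_n -> ray Sigma) x : t \subset s -> face_vec t rho x \in cs s.
Proof.
move=> ts; rewrite memvD // memv_suml // => k _; rewrite memvZ //; exact: w_span.
Qed.

Lemma ip_dual k r : r \in s -> ip (e k) (g r) = (r == k)%:R.
Proof. by move=> rs; rewrite ip_w. Qed.

Lemma ip_face_vec_fixed n t (rho : 'I_n -> ray Sigma) x k : enumerates t rho -> k \in t ->
  ip (face_vec t rho x) (g k) = z k.
Proof.
move=> [ts rinj rE] kt; have ks := fintype.subsetP ts _ kt.
rewrite ipDl !ip_suml (bigD1 k) //= ipZl ip_dual // eqxx mulr1.
rewrite big1 => [|l /andP[_ lk]]; last by rewrite ipZl ip_dual // eq_sym (negPf lk) mulr0.
rewrite big1 ?addr0 // => i _; rewrite ipZl ip_dual //; case: eqP => [kr|]; last by rewrite mulr0.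
by have := rE k; rewrite ks kt kr; move/esym/existsP; case; exists i.
Qed.

Lemma enumerates_in n t (rho : 'I_n -> ray Sigma) i : enumerates t rho ->
  rho i \in s /\ rho i \notin t.
Proof. by case=> _ _ /(_ (rho i)) rE; apply/andP; rewrite rE; apply/existsP; exists i. Qed.

Lemma ip_face_vec n t (rho : 'I_n -> ray Sigma) x i : enumerates t rho ->
  ip (face_vec t rho x) (g (rho i)) = tnth x i.
Proof.
move=> rE; have [rs rt] := enumerates_in i rE; case: rE => ts rinj rE.
rewrite ipDl !ip_suml big1 => [|k kt]; last first.
  by rewrite ipZl ip_dual //; case: eqP => [kr|]; rewrite ?mulr0 //; rewrite kr kt in rt.
rewrite add0r (bigD1 i) //= ipZl ip_dual // eqxx mulr1 big1 ?addr0 // => j /negPf ji.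
by rewrite ipZl ip_dual // (inj_eq rinj) eq_sym ji mulr0.
Qed.

Lemma face_vecP n t (rho : 'I_n -> ray Sigma) x v : enumerates t rho -> v \in cs s ->
  (forall k, k \in t -> ip v (g k) = z k) -> (forall i, ip v (g (rho i)) = tnth x i) ->
  v = face_vec t rho x.
Proof.
move=> rE vs vt vr; have [ts _ rE'] := rE.
rewrite [RHS](w_uniq (s := s) (z := fun r => ip v (g r))) ?face_vec_span //; first exact: w_uniq.
move=> r rs; have [rt|rt] := boolP (r \in t); first by rewrite ip_face_vec_fixed // vt.
have := rE' r; rewrite rs rt => /esym/existsP[i /eqP <-].
by rewrite ip_face_vec // vr.
Qed.

Lemma enumerates_setU1 n t (rho : 'I_n.+1 -> ray Sigma) i : enumerates t rho ->
  enumerates (rho i |: t)%SET (rho \o lift i).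
Proof.
move=> rE; have [rs rt] := enumerates_in i rE; case: rE => ts rinj rE; split.
- by rewrite finset.subUset finset.sub1set rs.
- by move=> j k /= /rinj /lift_inj.
- move=> r; rewrite in_setU1 negb_or andbCA rE; apply/andP/existsP.
    case=> ri /existsP[j /eqP rj]; case: (unliftP i j) => [k|] jE; last first.
      by rewrite -rj jE eqxx in ri.
    by exists k; rewrite /= -jE rj.
  case=> j /eqP <-; split; last by apply/existsP; exists (lift i j).
  by rewrite (inj_eq rinj) eq_sym neq_lift.
Qed.

Lemma measurable_forall d (T : measurableType d) (I : finType) (P : I -> set T) :
  (forall i, measurable (P i)) -> measurable [set x | forall i, P i x].
Proof.
move=> mP; rewrite (_ : [set x | _] = \bigcap_(i in [set: I]) P i).
  by apply: fin_bigcap_measurable => // i _; exact: mP.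
by apply/seteqP; split=> x /= xP i; [move=> _|]; apply: xP.
Qed.

Local Notation T := (Real.sort R).

Lemma measurable_affine n (f : n.-tuple R -> R) (c0 : R) (c : 'I_n -> R) :
  (forall x, f x = c0 + \sum_i tnth x i * c i) ->
  measurable_fun [set: n.-tuple T] (f : n.-tuple T -> T).
Proof.
move=> /funext ->; apply: measurable_funD => //; apply: measurable_sum => i.
by apply: measurable_funM => //; exact: measurable_tnth.
Qed.

Lemma measurable_lteif n (f h : n.-tuple R -> R) (b : bool) :
  measurable_fun [set: n.-tuple T] (f : n.-tuple T -> T) ->
  measurable_fun [set: n.-tuple T] (h : n.-tuple T -> T) ->
  measurable [set x : n.-tuple T | f x < h x ?<= if b].
Proof.
move=> mf mh; rewrite -[X in measurable X]setTI.
by case: b; [exact: (measurable_fun_ler mf mh measurableT (Y := [set true])) |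
             exact: (measurable_fun_ltr mf mh measurableT (Y := [set true]))].
Qed.

Lemma measurable_face n t (rho : 'I_n -> ray Sigma) b :
  measurable (face t rho b : set (n.-tuple T)).
Proof.
apply: measurableI.
  apply: measurable_forall => r; have [rs|rs] := boolP (r \in s); last first.
    by rewrite [X in measurable X](_ : _ = setT) //; apply/seteqP; split.
  rewrite [X in measurable X](_ : _ = [set x | 0 <= coef s r (face_vec t rho x)]); last first.
    by apply/seteqP; split=> x /=; [apply|].
  apply: (@measurable_lteif _ (fun=> 0) (fun x => coef s r (face_vec t rho x)) true) => //.
  apply: (measurable_affine (c0 := coef s r (\sum_(k in t) z k *: e k))
    (c := fun i => coef s r (e (rho i)))) => x.
  rewrite /face_vec /coef ipDl; congr (_ + _); rewrite ip_suml.
  by apply: eq_bigr => i _; rewrite ipZl.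
apply: measurable_forall => i.
apply: (@measurable_lteif _ (fun x => tnth x i) (fun=> z (rho i))) => //.
exact: measurable_tnth.
Qed.

Section Cells.
Variables (n : nat) (t : {set ray Sigma}) (rho : 'I_n.+1 -> ray Sigma) (b : 'I_n.+1 -> bool).
Hypothesis rhoE : enumerates t rho.
Let ts : t \subset s := let: And3 p _ _ := rhoE in p.
Let tC := cones_sub sC ts.
Local Notation om j := (ip (wv t z) (g (rho j))).

Let rtC j : (rho j |: t)%SET \in cones Sigma.
Proof.
by apply: cones_sub sC _; rewrite finset.subUset finset.sub1set ts (enumerates_in j rhoE).1.
Qed.

Let om_lt j : om j < z (rho j).
Proof. by apply: ip_w_lt => //; exact: (enumerates_in j rhoE).2. Qed.

Let om_gap j : 0 < z (rho j) - om j.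
Proof. by rewrite subr_gt0. Qed.

Definition slope (x : n.+1.-tuple R) j : R := (tnth x j - om j) / (z (rho j) - om j).

Definition cell i : set (n.+1.-tuple R) :=
  [set x | face t rho b x /\ forall j, slope x j < slope x i ?<= if ~~ (j < i)%N].

Lemma cell_partition x : \1_(face t rho b) x = \sum_i \1_(cell i) x :> R.
Proof.
have cell_sub i : cell i x -> face t rho b x by case.
have [xF|xF] := pselect (face t rho b x); last first.
  rewrite indicE memNset // big1 // => i _.
  by rewrite indicE memNset // => /cell_sub.
have [j0 _ j0max'] := @arg_maxP _ _ _ ord0 xpredT (slope x) isT.
have j0max j : slope x j <= slope x j0 := j0max' j isT.
have [i0 /eqP i0E i0min] := arg_minnP (P := fun i => slope x i == slope x j0) val (eqxx (slope x j0)).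
have i0C : cell i0 x.
  split=> // j; rewrite /= i0E; case: ltnP => ji /=; last exact: j0max.
  rewrite lt_neqAle j0max // andbT; apply: contraTneq ji => /eqP/i0min.
  by rewrite leqNgt.
rewrite (bigD1 i0) //= !indicE !mem_set // big1 ?addr0 // => i ii0.
rewrite indicE memNset // => -[_ iC].
have := iC i0; have := i0C.2 i; move: ii0; rewrite -val_eqE neq_ltn => /orP[] lt_i.
  rewrite lt_i (ltnNge i0) (ltnW lt_i) /= => h1 h2.
  by have := le_lt_trans h2 h1; rewrite ltxx.
rewrite lt_i (ltnNge i) (ltnW lt_i) /= => h1 h2.
by have := le_lt_trans h1 h2; rewrite ltxx.
Qed.

Lemma measurable_cell i : measurable (cell i : set (n.+1.-tuple T)).
Proof.
apply: measurableI; first exact: measurable_face.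
have mslope j : measurable_fun [set: n.+1.-tuple T] ((fun x => slope x j) : n.+1.-tuple T -> T).
  apply: measurable_funM => //; apply: measurable_funB => //; exact: measurable_tnth.
by apply: measurable_forall => j; exact: measurable_lteif.
Qed.

(* Points of a cell lie strictly beyond the apex w_t: otherwise v - w_t would
   have nonpositive norm. *)
Lemma cell_gt i x : cell i x -> tnth x i <= om i -> tnth x i = om i.
Proof.
move=> [[x0 xb] xi] xom.
have sle j : tnth x j <= om j.
  have : slope x j <= slope x i := lteifW (xi j).
  rewrite ler_pdivrMr // => /le_trans h; rewrite -subr_le0; apply: h.
  rewrite mulrAC -mulrA pmulr_lle0; last by rewrite divr_gt0.
  by rewrite subr_le0.
pose u := face_vec t rho x - wv t z.
have us : u \in cs s by rewrite memvB ?face_vec_span ?(spanS ts) ?w_span.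
suff u0 : u = 0.
  by apply/eqP; rewrite -subr_eq0 -(ip_face_vec x i rhoE) -ipBl -/u u0 ip0l.
apply: (ip_le0 (ip := ip)); rewrite {2}(sum_coef sC us) ip_sumr; apply: sumr_le0 => r rs.
rewrite ipZr; have [rt|rt] := boolP (r \in t).
  by rewrite ipBl ip_face_vec_fixed // ip_w // subrr mulr0.
have [_ _ /(_ r)] := rhoE; rewrite rs rt => /esym/existsP[j /eqP rj].
apply: mulr_ge0_le0; last by rewrite ipBl -rj ip_face_vec // subr_le0.
rewrite /u -[face_vec _ _ _]scale1r -scaleN1r coefD (coef_notin sC ts rs rt (w_span _ tC)).
by rewrite mulr0 addr0 mul1r x0.
Qed.

Definition apex (i : 'I_n.+1) : n.-tuple R := [tuple om (lift i j) | j < n].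

Lemma cell_slice i x : x != om i -> x != z (rho i) ->
  [set y : n.-tuple R | cell i (tins i x y)] =
  if om i < x < z (rho i) then let l := (x - om i) / (z (rho i) - om i) in
    [set y | face (rho i |: t)%SET (rho \o lift i) (fun j => ~~ (lift i j < i)%N)
      [tuple tnth (apex i) j + l^-1 * (tnth y j - tnth (apex i) j) | j < n]]
  else set0.
Proof.
move=> xom xz; have rE' := enumerates_setU1 i rhoE.
case: ifPn => [/andP[omx xzi]|xnot]; last first.
  apply/seteqP; split=> // y /= yC; apply: (negP xnot).
  have [[_ /(_ i)]] := yC; rewrite tnth_tins => /lteifW xzi _.
  rewrite !lt_neqAle xzi xz eq_sym xom !andbT /= leNgt; apply/negP => /ltW xi.
  have := cell_gt yC; rewrite tnth_tins => /(_ xi) xE.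
  by rewrite xE eqxx in xom.
set l := (x - om i) / (z (rho i) - om i) => /=; set c := apex i.
have l0 : 0 < l by rewrite divr_gt0 // subr_gt0.
have l1 : l < 1 by rewrite ltr_pdivrMr // mul1r ltrD2r.
have ln0 : l != 0 by rewrite gt_eqF.
have ge1l : 0 <= 1 - l by rewrite subr_ge0 ltW.
have xE : x = om i + l * (z (rho i) - om i) by rewrite divfK ?gt_eqF // addrC subrK.
apply/seteqP; suff H y : cell i (tins i x y) <->
  face (rho i |: t)%SET (rho \o lift i) (fun j => ~~ (lift i j < i)%N)
      [tuple tnth c j + l^-1 * (tnth y j - tnth c j) | j < n] by split=> y /= /H.
set y' := [tuple _ | j < n].
have yE j : tnth y j = om (lift i j) + l * (tnth y' j - om (lift i j)).
  by rewrite /y' tnth_mktuple /c /apex tnth_mktuple; field.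
have slope_i : slope (tins i x y) i = l by rewrite /slope tnth_tins.
have slope_j j : slope (tins i x y) (lift i j) = 
    l * ((tnth y' j - om (lift i j)) / (z (rho (lift i j)) - om (lift i j))).
  by rewrite /slope tnth_tins_lift yE addrAC subrr add0r mulrA.
set v := face_vec t rho (tins i x y).
set v' := face_vec (rho i |: t)%SET (rho \o lift i) y'.
have v's : v' \in cs s by rewrite face_vec_span; case: rE'.
have ws : wv t z \in cs s by rewrite (spanS ts) ?w_span.
have vE : v = l *: v' + (1 - l) *: wv t z.
  apply/esym/face_vecP => // [|k kt|j].
  - by rewrite memvD ?memvZ.
  - rewrite ipDl !ipZl (ip_face_vec_fixed _ rE') ?in_setU1 ?kt ?orbT // ip_w //; ring.
  rewrite ipDl !ipZl; case: (unliftP i j) => [k|] ->.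
    rewrite tnth_tins_lift yE (ip_face_vec _ k rE'); ring.
  rewrite tnth_tins (ip_face_vec_fixed _ rE') ?finset.setU11 // [in RHS]xE; ring.
have coefv r : coef s r v = l * coef s r v' + (1 - l) * coef s r (wv t z) by rewrite vE coefD.
split=> [[[v0 vb] vi]|[v'0 v'b]].
  have v'z j : tnth y' j < z (rho (lift i j)) ?<= if ~~ (lift i j < i)%N.
    have := vi (lift i j); rewrite slope_i slope_j.
    rewrite -[X in _ < X ?<= if _]mulr1 lteif_pM2l // lteif_pdivrMr // mul1r.
    by rewrite lteifD2r.
  split=> // r rs; suff /(coneP _ sC)[_ /(_ r rs)] : cone s v' by [].
  have [t's _ t'E] := rE'.
  apply: (face_hull zC sC t's) => //; first exact: cone_convex.
  - by move=> t' _ t's'; apply: cone_w.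
  - move=> k ks kt; have kt' : k \notin t by apply: contra kt; rewrite in_setU1 => ->; rewrite orbT.
    have := v0 k ks; rewrite -/v coefv (coef_notin sC ts ks kt' (w_span _ tC)) mulr0 addr0.
    by rewrite pmulr_rge0.
  - by move=> k kt; rewrite (ip_face_vec_fixed _ rE').
  - move=> k ks; have [kt|kt] := boolP (k \in (rho i |: t)%SET).
      by rewrite (ip_face_vec_fixed _ rE').
    have := t'E k; rewrite ks kt => /esym/existsP[j /eqP <-].
    by rewrite (ip_face_vec _ j rE') (lteifW (v'z j)).
have v'z j : tnth y' j <= z (rho (lift i j)) := lteifW (v'b j).
split; first split.
- move=> r rs; rewrite -/v coefv addr_ge0 // mulr_ge0 ?(ltW l0) //; first exact: v'0.
  exact: coef_w_ge0.
- move=> j; apply: lteifS; case: (unliftP i j) => [k|] ->; last by rewrite tnth_tins.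
  rewrite tnth_tins_lift yE -ltrBrDl.
  apply: (@le_lt_trans _ _ (l * (z (rho (lift i k)) - om (lift i k)))).
    by rewrite ler_pM2l // lerD2r.
  by rewrite -[X in _ < X]mul1r ltr_pM2r.
move=> j; rewrite slope_i; case: (unliftP i j) => [k|] ->; last by rewrite slope_i ltnn /=.
rewrite slope_j -[X in _ < X ?<= if _]mulr1 lteif_pM2l // lteif_pdivrMr // mul1r lteifD2r.
exact: v'b.
Qed.

End Cells.

Lemma lebesgue_vol_face n t (rho : 'I_n -> ray Sigma) b : enumerates t rho ->
  lebesgue_vol (face t rho b) = (n`!%:R^-1 * volc n s t z)%:E.
Proof.
elim: n t rho b => [|n IH] t rho b rhoE; have [ts rinj rE] := rhoE.
  have tE : t = s.
    apply/eqP; rewrite finset.eqEsubset ts; apply/fintype.subsetP => k ks.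
    by apply: contraT => kt; have := rE k; rewrite ks kt => /esym/existsP[[]].
  rewrite /= indicE mem_set ?invr1 ?mulr1 //; split=> [r rs|[]//].
  rewrite (_ : face_vec _ _ _ = wv s z) ?ltW ?zC //.
  by apply/esym/face_vecP => // [|k ks|[]//]; rewrite ?w_span ?ip_w ?(fintype.subsetP ts).
rewrite (lebesgue_vol_sum (B := cell t rho b)); last 2 first.
- by move=> i; exact: measurable_cell.
- by move=> x; exact: cell_partition.
transitivity (\sum_(i < n.+1) (zst t z (rho i) * n.+1%:R^-1 *
    (n`!%:R^-1 * volc n s (rho i |: t)%SET z))%:E)%E.
  apply: eq_bigr => i _.
  have [rs rt] := enumerates_in i rhoE.
  have om_lt : ip (wv t z) (g (rho i)) < z (rho i).
    apply: ip_w_lt => //; apply: cones_sub sC _.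
    by rewrite finset.subUset finset.sub1set ts rs.
  have := @lebesgue_vol_cone R n (cell t rho b i) _ i (apex t rho i)
    (ip (wv t z) (g (rho i))) (z (rho i)) _ (@measurable_cell n t rho b i) (measurable_face _ _ _)
    om_lt (IH _ _ (fun j => ~~ (lift i j < i)%N) (enumerates_setU1 i rhoE)).
  by apply=> x; exact: (cell_slice b rhoE).
rewrite sumEFin factS natrM invfM; congr _%:E => /=.
rewrite (eq_bigl (fun r => r \in [set rho i | i : 'I_n.+1]%SET)) => [|r]; last first.
  by rewrite rE; apply/existsP/imsetP => [[i /eqP]|[i _ ->]]; exists i.
rewrite big_imset /=; last by move=> i j _ _; exact: rinj.
rewrite mulr_sumr; apply: eq_bigr => i _; ring.
Qed.

End Face.

Lemma Vol_P s z : s \in cones Sigma -> cubical z ->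
  Vol_ ip s (P_ ip s z) = volc #|s| s finset.set0 z.
Proof.
move=> sC zC; pose rho (i : 'I_#|s|) : ray Sigma := enum_val i.
have rhoE : enumerates s finset.set0 rho.
  split=> [||r]; [exact: finset.sub0set|exact: enum_val_inj|rewrite inE andbT].
  apply/idP/existsP => [rs|[i /eqP <-]]; last exact: enum_valP.
  by exists (enum_rank_in rs r); rewrite /rho enum_rankK_in.
rewrite /Vol_ (_ : [set x | _] = face s z finset.set0 rho xpredT).
  by rewrite (lebesgue_vol_face sC zC _ rhoE) /= mulrA divff ?mul1r // pnatr_eq0 -lt0n fact_gt0.
apply/seteqP; suff H (x : #|s|.-tuple R) :
    P_ ip s z (\sum_(i < #|s|) tnth x i *: dual_basis ip s (enum_val i)) <->
    face s z finset.set0 rho xpredT x by split=> x /= /H.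
rewrite (_ : \sum_(i < _) _ = face_vec s z finset.set0 rho x); last first.
  by rewrite /face_vec big_set0 add0r.
split=> [[/(coneP _ sC)[_ x0] xz]|[x0 xz]].
  by split=> // i; rewrite -(ip_face_vec z sC x i rhoE); apply: xz; exact: enum_valP.
split; first by apply/(coneP _ sC); split=> //; apply: face_vec_span => //; exact: finset.sub0set.
move=> r rs; have [_ _ /(_ r)] := rhoE; rewrite rs inE => /esym/existsP[i /eqP <-].
by rewrite (ip_face_vec z sC x i rhoE); exact: xz.
Qed.

Lemma Vol_set0 s : s \in cones Sigma -> (0 < #|s|)%N -> Vol_ ip s [set 0] = 0.
Proof.
move=> sC; rewrite /Vol_ => s0; rewrite [X in fine X](_ : _ = 0%E) ?mulr0 //.
rewrite (_ : [set x | _] = [set x | forall i, tnth x i = 0]); last first.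
  apply/seteqP; split=> x /= x0; last by rewrite big1 // => i _; rewrite x0 scale0r.
  move=> i; have iS := enum_valP i.
  have := congr1 (fun v => ip v (g (enum_val i))) x0; rewrite ip0l ip_suml (bigD1 i) //=.
  rewrite ipZl ip_w // eqxx mulr1 big1 ?addr0 // => j /negPf ji.
  by rewrite ipZl ip_w // (inj_eq enum_val_inj) eq_sym ji mulr0.
case: #|s| s0 => // n _.
rewrite (_ : 0%E = \int[@lebesgue_measure R]_x 0)%E; last by rewrite integral0.
have mA : measurable ([set x | forall i, tnth x i = 0] : set (n.+1.-tuple (Real.sort R))).
  apply: measurable_forall => i.
  apply: (@preimage_measurable _ _ (n.+1.-tuple (Real.sort R)) (Real.sort R)
    (fun x => tnth x i) [set 0]); first exact: measurable_tnth.
  exact: measurable_set1.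
apply: ge0_ae_eq_integral => //.
- exact: (measurable_slice_vol mA).
- by move=> x _; exact: lebesgue_vol_ge0.
exists [set 0]; split.
- exact: measurable_set1.
- by rewrite /= lebesgue_measure_set1.
move=> x /= /not_implyP[_]; apply: contra_notP => x0.
rewrite (_ : [set t | _] = set0); first exact: lebesgue_vol0.
by apply/seteqP; split=> // t /= /(_ ord0).
Qed.

Lemma free_gen s : s \in cones Sigma -> free [seq g r | r <- enum s].
Proof.
move=> sC; have : {subset enum s <= s} by move=> r; rewrite mem_enum.
elim: (enum s) (enum_uniq s) => [|r l IH] /= => [_ _|/andP[rl lu] ls]; first by rewrite nil_free.
rewrite free_cons IH ?andbT // => [|k kl]; last by apply: ls; rewrite inE kl orbT.
pose t := [set k in l]%SET; have rt : r \notin t by rewrite inE.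
have rtC : (r |: t)%SET \in cones Sigma.
  by apply: cones_sub sC _; apply/fintype.subsetP => k; rewrite !inE; exact: ls.
apply: contra (gen_notin_span rtC rt); move: (g r); apply/subvP.
apply/span_subvP => _ /mapP[k kl ->]; apply: gen_span; by rewrite inE.
Qed.

Lemma cones_of_dimE d : cones_of_dim Sigma d = [set s in cones Sigma | #|s| == d]%SET.
Proof.
apply/setP => s; rewrite !inE; case sC : (s \in cones Sigma) => //=.
by rewrite /cone_span (eqnP (free_gen sC)) size_map -cardE.
Qed.

(** * Mixed volumes of stars *)

Definition link t : {set ray Sigma} :=
  [set r | (r \notin t) && ((r |: t)%SET \in cones Sigma)]%SET.

Lemma linkP t r : reflect (r \notin t /\ (r |: t)%SET \in cones Sigma) (r \in link t).
Proof. by rewrite inE; exact: andP. Qed.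

Fixpoint mvol t (zs : seq (ray Sigma -> R)) : R :=
  if zs is z :: zs' then \sum_(r in link t) zst t z r * mvol (r |: t)%SET zs' else 1.

Lemma mvol_nseq n t z : t \in cones Sigma -> mvol t (nseq n z) =
  \sum_(s in cones Sigma | (t \subset s) && (#|s| == #|t| + n)%N) volc n s t z.
Proof.
elim: n t => [|n IH] t tC /=.
  rewrite (big_pred1 t) // => s; rewrite addn0; apply/andP/eqP => [[sC /andP[ts /eqP st]]|->].
    by apply/eqP; rewrite eq_sym finset.eqEcard ts st leqnn.
  by rewrite fintype.subxx eqxx.
under [RHS]eq_bigr do rewrite big_mkcondr big_mkcond /=.
rewrite exchange_big /= big_mkcond; apply: eq_bigr => r _; case: (boolP (r \in link t)).
  move=> /linkP[rt rtC]; rewrite IH // mulr_sumr [RHS]big_mkcond [LHS]big_mkcond.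
  apply: eq_bigr => s _; case sC : (s \in cones Sigma) => //=.
  rewrite finset.subUset finset.sub1set cardsU1 rt /= add1n addSnnS.
  by case: (r \in s) => /=; rewrite ?if_same.
move=> rN; rewrite big1 // => s /andP[sC /andP[ts _]].
case rs : (r \in s) => //; case rt : (r \in t) => //=.
move: rN; rewrite inE rt /= => /negP[]; apply: cones_sub sC _.
by rewrite finset.subUset finset.sub1set rs.
Qed.

Lemma mvol_lin t a x b y zs : t \in cones Sigma ->
  mvol t ((fun r => a * x r + b * y r) :: zs) = a * mvol t (x :: zs) + b * mvol t (y :: zs).
Proof.
move=> tC /=; rewrite !mulr_sumr -big_split /=; apply: eq_bigr => r _.
by rewrite zst_lin //; ring.
Qed.

Lemma mvol_swap t x y zs : t \in cones Sigma -> mvol t (x :: y :: zs) = mvol t (y :: x :: zs).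
Proof.
move=> tC.
pose K r := \sum_(k in link (r |: t)%SET) zcoef t r k * mvol (k |: (r |: t))%SET zs.
have E (u v : ray Sigma -> R) : mvol t (u :: v :: zs) =
    (\sum_(r in link t) \sum_(k in link (r |: t)%SET)
       zst t u r * zst t v k * mvol (k |: (r |: t))%SET zs) -
    \sum_(r in link t) zst t u r * zst t v r * K r.
  rewrite /= -sumrB; apply: eq_bigr => r /linkP[rt rtC].
  rewrite !mulr_sumr -sumrB; apply: eq_bigr => k _.
  by rewrite zst_setU1 //; ring.
rewrite !E; congr (_ - _); last by apply: eq_bigr => r _; rewrite [zst t x r * _]mulrC.
rewrite (exchange_big_dep (mem (link t))) /=; last first.
  move=> r k /linkP[rt rtC] /linkP[]; rewrite in_setU1 negb_or => /andP[kr kt] krC.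
  apply/linkP; split=> //; apply: cones_sub krC _.
  by rewrite finset.setUS // finset.subsetUr.
apply: eq_bigr => k /linkP[kt ktC].
have kE r : [&& r \in link t & k \in link (r |: t)%SET] = (r \in link (k |: t)%SET).
  rewrite !inE !negb_or [(k |: (r |: t))%SET]finset.setUCA [k == r]eq_sym.
  apply/andP/andP => [[/andP[rt rtC] /andP[/andP[kr _] krC]]|[/andP[rk rt] rkC]]; first by rewrite kr rt.
  rewrite rt kt rk; split=> //=; apply: cones_sub rkC _.
  by rewrite finset.setUS // finset.subsetUr.
rewrite (eq_bigl _ _ kE); apply: eq_bigr => r _.
by rewrite [(k |: (r |: t))%SET]finset.setUCA; ring.
Qed.

Lemma mvol_mid t a x b : t \in cones Sigma -> mvol t (a ++ x :: b) = mvol t (x :: a ++ b).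
Proof.
elim: a t => [//|y a IH] t tC; rewrite cat_cons -[RHS]mvol_swap //=.
by apply: eq_bigr => r /linkP[_ rtC]; rewrite IH.
Qed.

Section Polarization.
Variables (I : finType) (z : I -> ray Sigma -> R).

Lemma mvol_perm t (l l' : seq I) : t \in cones Sigma -> perm_eq l l' ->
  mvol t (map z l) = mvol t (map z l').
Proof.
elim: l t l' => [|i l IH] t l' tC ll'; first by move: ll'; rewrite perm_sym => /perm_nilP ->.
have il' : i \in l' by rewrite -(perm_mem ll') inE eqxx.
case/splitPr: il' ll' => l1 l2 ll'.
rewrite map_cat /= mvol_mid // -map_cat /=.
apply: eq_bigr => r /linkP[_ rtC]; congr (_ * _); apply: IH => //.
by rewrite -(perm_cons i) (perm_trans ll') // perm_catC /= perm_cons perm_catC.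
Qed.

Lemma zst_sum t (A : {set I}) r : t \in cones Sigma ->
  zst t (fun k => \sum_(i in A) z i k) r = \sum_(i in A) zst t (z i) r.
Proof.
by move=> tC; rewrite /zst w_sum // ip_suml sumrB.
Qed.

Lemma mvol_expand t n (A : {set I}) : t \in cones Sigma ->
  mvol t (nseq n (fun k => \sum_(i in A) z i k)) =
  \sum_(f : n.-tuple I | all (mem A) f) mvol t (map z f).
Proof.
elim: n t => [|n IH] t tC /=.
  by rewrite (big_pred1 [tuple]) // => f; rewrite [f]tuple0 /= eqxx.
rewrite (reindex (fun p : I * n.-tuple I => [tuple of p.1 :: p.2])) /=; last first.
  exists (fun f => (thead f, [tuple of behead f])) => [[i f] _|f _] /=.
    by congr (_, _); apply: val_inj.
  by rewrite -tuple_eta.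
rewrite -(pair_big (mem A) (fun f : n.-tuple I => all (mem A) f)
  (fun i f => \sum_(r in link t) zst t (z i) r * mvol (r |: t)%SET (map z f))) /=.
under [RHS]eq_bigr do rewrite exchange_big /=.
rewrite exchange_big /=; apply: eq_bigr => r /linkP[_ rtC].
rewrite zst_sum // IH // mulr_suml; apply: eq_bigr => i _.
by rewrite mulr_sumr.
Qed.

Lemma alternating_sum (B : {set I}) :
  \sum_(A : {set I} | B \subset A) (-1) ^+ (#|I| - #|A|) = (B == [set: I]%SET)%:R :> R.
Proof.
transitivity (\prod_(i : I) (1 + (if i \in B then 0 else -1)) : R).
  rewrite bigA_distr /= [LHS]big_mkcond; apply: eq_bigr => A _.
  case: ifPn => [/fintype.subsetP BA|/subsetPn[i iB iA]]; last first.
    by rewrite (bigD1 i) //= (negPf iA) iB mul0r.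
  rewrite (bigID (mem A)) /= big1 ?mul1r => [|i ->//].
  rewrite (eq_bigr (fun=> -1)) => [|i iA]; last first.
    by rewrite (negPf iA); case: ifPn => // /BA; rewrite (negPf iA).
  rewrite prodr_const; congr (_ ^+ _).
  by rewrite -(cardC (mem A)) addKn; apply: eq_card.
case: eqP => [->|/eqP BT].
  by rewrite big1 // => i _; rewrite inE addr0.
have [i iB] : exists i, i \notin B.
  apply/existsP; apply: contraNT BT; rewrite negb_exists => /forallP BT.
  by apply/eqP/setP => i; rewrite inE; have := BT i; rewrite negbK.
by rewrite (bigD1 i) //= (negPf iB) subrr mul0r.
Qed.

End Polarization.

Lemma mvol_polarization t d (z : 'I_d -> ray Sigma -> R) : t \in cones Sigma ->
  \sum_(A : {set 'I_d}) (-1) ^+ (d - #|A|) * mvol t (nseq d (fun k => \sum_(i in A) z i k)) =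
  d`!%:R * mvol t (map z (enum 'I_d)).
Proof.
move=> tC; under eq_bigr do rewrite mvol_expand // mulr_sumr.
rewrite (exchange_big_dep predT) //=.
under eq_bigr => f _.
  rewrite -mulr_suml (eq_bigl (fun A : {set 'I_d} => [set i in f]%SET \subset A)); last first.
    move=> A; apply/allP/fintype.subsetP => fA i; first by rewrite inE; exact: fA.
    by move=> fi; apply: fA; rewrite inE.
  rewrite (eq_bigr (fun A : {set 'I_d} => (-1) ^+ (#|'I_d| - #|A|))) => [|A _]; last by rewrite card_ord.
  rewrite alternating_sum.
  over.
have uE (f : d.-tuple 'I_d) : ([set i in f]%SET == [set: 'I_d]%SET) = uniq f.
  rewrite finset.eqEcard finset.subsetT cardsT card_ord cardsE /=.
  have fd := card_size f; rewrite size_tuple in fd.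
  apply/idP/card_uniqP; rewrite size_tuple => h; last by rewrite h.
  by apply/eqP; rewrite eqn_leq h fd.
rewrite (bigID (fun f : d.-tuple 'I_d => uniq f)) /= [X in _ + X]big1 ?addr0 => [|f /negPf fu]; last first.
  by rewrite uE fu mul0r.
rewrite (eq_bigr (fun=> mvol t (map z (enum 'I_d)))) => [|f fu]; last first.
  rewrite uE fu mul1r; apply: mvol_perm => //; apply: uniq_perm; rewrite ?enum_uniq // => i.
  by rewrite mem_enum; have := uE f; rewrite fu => /eqP/setP/(_ i); rewrite !inE.
rewrite sumr_const mulr_natl; congr (_ *+ _).
have := @card_uniq_tuples _ d (predT : pred 'I_d).
rewrite card_ord ffactnn => <-; rewrite cardsE; apply: eq_card => f.
by rewrite unfold_in /= [RHS]unfold_in all_predT.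
Qed.

Lemma zst0 t r : t \in cones Sigma -> zst t (fun=> 0) r = 0.
Proof.
move=> tC; rewrite (_ : (fun=> 0) = (fun k : ray Sigma => 0 * 0 + 0 * 0)).
  by rewrite zst_lin // !mul0r addr0.
by apply/funext => k; rewrite mulr0 addr0.
Qed.

Lemma MVol_mvol d (z : 'I_d -> ray Sigma -> R) : (0 < d)%N -> finset.set0 \in cones Sigma ->
  (forall i, cubical (z i)) ->
  MVol Sigma ip d z = mvol finset.set0 (map z (enum 'I_d)).
Proof.
move=> d0 C0 zC; apply: (@mulfI _ d`!%:R); first by rewrite pnatr_eq0 -lt0n fact_gt0.
rewrite -mvol_polarization // /MVol cones_of_dimE mulr_sumr.
transitivity (\sum_(s in cones Sigma | #|s| == d) \sum_(A : {set 'I_d})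
    (-1) ^+ (d - #|A|) * volc d s finset.set0 (fun k => \sum_(i in A) z i k)).
  rewrite [LHS](eq_bigl (fun s => (s \in cones Sigma) && (#|s| == d))) => [|s]; last by rewrite inE.
  apply: eq_bigr => s /andP[sC /eqP sd].
  have polyP i := polytope_P (zC i) sC.
  rewrite /MVol_ mixed_volumeE // /polarization mulrA divff ?mul1r; last first.
    by rewrite pnatr_eq0 -lt0n fact_gt0.
  apply: eq_bigr => A _; congr (_ * _); have [->|A0] := eqVneq A finset.set0.
    rewrite (minkowski_sum0 polyP) Vol_set0 ?sd //.
    rewrite (_ : (fun k => _) = fun=> 0); last by apply/funext => k; rewrite big_set0.
    by rewrite -(prednK d0) /= big1 // => r _; rewrite zst0 // mul0r.
  by rewrite minkowski_sum_P // Vol_P ?sd //; exact: cubical_sum.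
rewrite exchange_big; apply: eq_bigr => A _; rewrite -mulr_sumr mvol_nseq //.
by congr (_ * _); apply: eq_bigl => s; rewrite finset.sub0set cards0 add0n.
Qed.

Lemma mvol_cons t z zs :
  mvol t (z :: zs) = \sum_(r in link t) zst t z r * mvol (r |: t)%SET zs.
Proof. by []. Qed.

Definition lorentzian t zs := forall x y : ray Sigma -> R, 0 < mvol t (x :: x :: zs) ->
  mvol t (x :: x :: zs) * mvol t (y :: y :: zs) <= mvol t (x :: y :: zs) ^+ 2.

Lemma mvol2_sqr t zs (k : R) (x y : ray Sigma -> R) : t \in cones Sigma ->
  let u := (fun r => 1 * y r + (- k) * x r) in
  mvol t (u :: u :: zs) =
  mvol t (y :: y :: zs) - 2 * k * mvol t (x :: y :: zs) + k ^+ 2 * mvol t (x :: x :: zs).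
Proof.
move=> tC u.
have lin zs' : mvol t (u :: zs') = 1 * mvol t (y :: zs') + - k * mvol t (x :: zs').
  exact: mvol_lin.
by rewrite lin !(mvol_swap _ u) // !lin (mvol_swap y x) //; ring.
Qed.

Lemma lorentzian_of_functional t zs (l : (ray Sigma -> R) -> R) : t \in cones Sigma ->
  (forall a x b y, l (fun r => a * x r + b * y r) = a * l x + b * l y) ->
  (forall y, l y = 0 -> mvol t (y :: y :: zs) <= 0) -> lorentzian t zs.
Proof.
move=> tC l_lin l0 x y xx.
have lx : l x != 0 by apply: contraTneq xx => /l0; rewrite leNgt.
apply: (@reverse_cs _ _ _ _ (l y / l x)) => //.
by rewrite -mvol2_sqr //; apply: l0; rewrite l_lin; field.
Qed.

Lemma link_setU1_sym t r k : r \in link t -> k \in link (r |: t)%SET ->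
  k \in link t /\ r \in link (k |: t)%SET.
Proof.
move=> /linkP[rt rtC]; rewrite !inE !negb_or finset.setUCA => /andP[/andP[kr kt] krC].
rewrite kt rt eq_sym kr krC; split=> //=; apply: cones_sub krC _.
exact: finset.subsetUr.
Qed.

Section Induction.
Variable d : nat.
Hypotheses
  (link_neq0 : forall t, t \in cones Sigma -> (#|t| < d)%N -> link t != finset.set0)
  (link_conn : forall t, t \in cones Sigma -> (#|t| + 3 <= d)%N ->
    forall f : ray Sigma -> R,
    (forall r k, r \in link t -> k \in link (r |: t)%SET -> f r = f k) ->
    forall r k, r \in link t -> k \in link t -> f r = f k)
  (lorentzian2 : forall t, t \in cones Sigma -> (#|t| + 2)%N = d -> lorentzian t [::]).

Lemma mvol_gt0 t zs : t \in cones Sigma -> (#|t| + size zs <= d)%N ->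
  (forall z, List.In z zs -> cubical z) -> 0 < mvol t zs.
Proof.
elim: zs t => [|z zs IH] t tC td zC; first exact: ltr01.
have pos r : r \in link t -> 0 < zst t z r * mvol (r |: t)%SET zs.
  move=> /linkP[rt rtC]; apply: mulr_gt0; first by apply: zst_gt0 => //; apply: zC; left.
  apply: IH => // [|z' z'zs]; last by apply: zC; right.
  by rewrite cardsU1 rt add1n addSnnS.
have /set0Pn[r rL] : link t != finset.set0.
  by apply: link_neq0 => //; apply: leq_trans td; rewrite /= addnS ltnS leq_addr.
rewrite /= (bigD1 r) //=; apply: ltr_pwDl; first exact: pos.
by apply: sumr_ge0 => k /andP[kL _]; rewrite ltW ?pos.
Qed.

Section Step.
Variables (t : {set ray Sigma}) (v : ray Sigma -> R) (zs : seq (ray Sigma -> R)).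
Hypotheses (tC : t \in cones Sigma) (td : (#|t| + size zs + 3 = d)%N)
  (vC : cubical v) (zsC : forall z, List.In z zs -> cubical z)
  (IH : forall r, r \in link t -> lorentzian (r |: t)%SET zs).

Let n := #|link t|.
Let e (i : 'I_n) : ray Sigma := enum_val i.

Let eL i : e i \in link t. Proof. exact: enum_valP. Qed.

Let etC i : (e i |: t)%SET \in cones Sigma. Proof. by have /linkP[] := eL i. Qed.

Let eN i : e i \notin t. Proof. by have /linkP[] := eL i. Qed.

Let card_et i : #|(e i |: t)%SET| = #|t|.+1. Proof. by rewrite cardsU1 eN. Qed.

(* The matrix of mvol t (x :: y :: v :: zs) in the coordinates zst t _ (e i); its
   diagonal collects the corrections from [zst_setU1]. *)
Let m (i j : 'I_n) : R :=
  if e j \in link (e i |: t)%SET then mvol (e j |: (e i |: t))%SET (v :: zs) else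
  if i == j then - \sum_(k in link (e i |: t)%SET)
     zcoef t (e i) k * mvol (k |: (e i |: t))%SET (v :: zs) else 0.

Let bE (y : ray Sigma -> R) i :
  mvol (e i |: t)%SET (y :: v :: zs) = \sum_j m i j * zst t y (e j).
Proof.
pose M k := mvol (k |: (e i |: t))%SET (v :: zs).
transitivity (\sum_(k in link (e i |: t)%SET) zst t y k * M k -
    zst t y (e i) * \sum_(k in link (e i |: t)%SET) zcoef t (e i) k * M k).
  rewrite mvol_cons mulr_sumr -sumrB; apply: eq_bigr => k _.
  by rewrite zst_setU1 // -/(M k); ring.
rewrite (bigID (fun j => e j \in link (e i |: t)%SET)) /=; congr (_ + _).
  rewrite [LHS](eq_bigl (fun k => (k \in link t) && (k \in link (e i |: t)%SET))); last first.
    by move=> k; apply/idP/andP => [kL|[]//]; have [] := link_setU1_sym (eL i) kL.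
  rewrite big_enum_val_cond /=; apply: eq_bigr => j jL.
  by rewrite /m jL mulrC.
rewrite (bigD1 i) /=; last by rewrite inE finset.setU11.
rewrite {1}/m eqxx ifN; last by rewrite inE finset.setU11.
rewrite [X in _ + X]big1 ?addr0 => [|j /andP[jL ji]]; last by rewrite /m (negPf jL) eq_sym (negPf ji) mul0r.
by rewrite mulNr mulrC.
Qed.

Let ext (y : 'I_n -> R) r : R := \sum_i y i * (r == e i)%:R.

Let ext_e y i : ext y (e i) = y i.
Proof.
rewrite /ext (bigD1 i) //= eqxx mulr1 big1 ?addr0 // => j /negPf ji.
by rewrite (inj_eq enum_val_inj) eq_sym ji mulr0.
Qed.

Let zst_ext y i : zst t (ext y) (e i) = y i.
Proof.
rewrite -[RHS](ext_e y) -[RHS]subr0 -(zst0 (e i) tC) /zst sub0r opprK.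
rewrite (w_eq (z' := fun=> 0)) // => [|k kt]; last first.
  rewrite /ext big1 // => j _; case: eqP => [kj|]; last by rewrite mulr0.
  by move: (eN j); rewrite -kj kt.
have := zst0 (e i) tC; rewrite /zst sub0r => /eqP; rewrite oppr_eq0 => /eqP ->.
by rewrite subr0 addr0.
Qed.

Lemma mvol_step_le0 y : mvol t (y :: v :: v :: zs) = 0 -> mvol t (y :: y :: v :: zs) <= 0.
Proof.
have sumE (x y' : ray Sigma -> R) : mvol t (x :: y' :: v :: zs) =
    \sum_i zst t x (e i) * \sum_j m i j * zst t y' (e j).
  rewrite mvol_cons big_enum_val; apply: eq_bigr => i _; congr (_ * _).
  exact: (bE y' i).
rewrite !sumE => yv.
apply: (@bochner_hyperbolic _ n m (fun i => zst t v (e i))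
  _ _ _ _ _ _ (fun i => zst t y (e i))) => //.
- move=> i j; rewrite /m; case: (boolP (e j \in _)) => [jL|jL].
    by have [_ ->] := link_setU1_sym (eL i) jL; rewrite finset.setUCA.
  case: (boolP (e i \in _)) => [iL|iL].
    by have [_ jL'] := link_setU1_sym (eL j) iL; rewrite jL' in jL.
  by rewrite eq_sym; case: eqP => // ->.
- move=> i j ij; rewrite /m (negPf ij); case: ifP => // /linkP[jN jC].
  apply/ltW/mvol_gt0 => // [|z /= [<-//|/zsC//]].
  by rewrite cardsU1 jN card_et /=; lia.
- by move=> i; apply: zst_gt0.
- move=> i; rewrite -bE; apply: mvol_gt0 => // [|z /= [<-//|[<-//|/zsC//]]].
  by rewrite card_et /=; lia.
- move=> f fc i j; rewrite -(ext_e f i) -(ext_e f j).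
  apply: (link_conn tC) => //; first by lia.
  move=> r k rL kL; have [kL' _] := link_setU1_sym rL kL.
  have [i' rE] : exists i', r = e i' by exists (enum_rank_in rL r); rewrite /e enum_rankK_in.
  have [j' kE] : exists j', k = e j' by exists (enum_rank_in kL' k); rewrite /e enum_rankK_in.
  rewrite rE kE !ext_e; apply: fc.
    by apply: contraTneq kL => ij; rewrite rE kE ij inE finset.setU11.
  rewrite /m -rE -kE kL; apply: mvol_gt0 => // [||z /= [<-//|/zsC//]].
  + by have /linkP[] := kL.
  + have /linkP[kN _] := kL.
    rewrite rE in kN; by rewrite rE cardsU1 kN card_et /=; lia.
- move=> y'; pose Y := ext y'.
  have y'E i : y' i = zst t Y (e i) by rewrite zst_ext.
  have bY i : \sum_j m i j * y' j = mvol (e i |: t)%SET (Y :: v :: zs).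
    by rewrite bE; apply: eq_bigr => j _; rewrite y'E.
  under eq_bigr do rewrite bY y'E; under [X in _ <= X]eq_bigr do rewrite bY -bE.
  have -> : \sum_i zst t Y (e i) * mvol (e i |: t)%SET (Y :: v :: zs) =
      \sum_i zst t v (e i) * mvol (e i |: t)%SET (Y :: Y :: zs).
    transitivity (mvol t (Y :: Y :: v :: zs)).
      by rewrite [RHS]mvol_cons [RHS]big_enum_val.
    by rewrite (@mvol_mid t [:: Y; Y] v zs tC) mvol_cons big_enum_val.
  apply: ler_sum => i _.
  have vi : 0 < zst t v (e i) by apply: zst_gt0.
  have vv : 0 < mvol (e i |: t)%SET (v :: v :: zs).
    apply: mvol_gt0 => // [|z /= [<-//|[<-//|/zsC//]]].
    by rewrite card_et /=; lia.
  rewrite -mulrA ler_pM2l // ler_pdivlMr // mulrC.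
  by rewrite (mvol_swap Y v) //; exact: (IH (eL i)).
Qed.

End Step.

Lemma lorentzian_link t zs : t \in cones Sigma -> (#|t| + size zs + 2)%N = d ->
  (forall z, List.In z zs -> cubical z) -> lorentzian t zs.
Proof.
elim: zs t => [|v zs IH] t tC td zC; first by apply: lorentzian2 => //; move: td => /=; lia.
apply: (@lorentzian_of_functional _ _ (fun y => mvol t (y :: v :: v :: zs))) => //.
  by move=> a x b y; rewrite mvol_lin.
move=> y; apply: mvol_step_le0 => //.
- by move: td => /=; lia.
- by apply: zC; left.
- by move=> z zzs; apply: zC; right.
move=> r /linkP[rt rtC]; apply: IH => // [|z zzs]; last by apply: zC; right.
by move: td; rewrite cardsU1 rt /=; lia.
Qed.

Lemma AF_of_link_conditions : (2 <= d)%N -> finset.set0 \in cones Sigma -> AF Sigma ip d.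
Proof.
move=> d2 C0 z i j i0 j1 zCub.
have zC k : cubical (z k) by apply: Cub_cubical.
have d0 : (0 < d)%N by apply: ltnW.
have ij : i != j by rewrite -val_eqE /= i0 j1.
pose l := [seq k <- enum 'I_d | (k != i) && (k != j)].
have perm_l : perm_eq (enum 'I_d) (i :: j :: l).
  apply: uniq_perm; rewrite ?enum_uniq //=.
    by rewrite inE negb_or ij !mem_filter !eqxx /= ?andbF /= filter_uniq ?enum_uniq.
  move=> k; rewrite [LHS]mem_enum !in_cons mem_filter mem_enum /= andbT.
  by case: (k == i); case: (k == j).
have l_size : (size l + 2)%N = d.
  by have := perm_size perm_l; rewrite size_enum_ord /= addn2.
have MVolE (y : 'I_d -> ray Sigma -> R) : (forall k, cubical (y k)) ->
    (forall k, k != i -> k != j -> y k = z k) ->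
    MVol Sigma ip d y = mvol finset.set0 (y i :: y j :: map z l).
  move=> yC yz; rewrite MVol_mvol // (mvol_perm _ C0 perm_l) !map_cons.
  congr (mvol _ (_ :: _ :: _)).
  by apply/eq_in_map => k; rewrite mem_filter => /andP[/andP[ki kj] _]; exact: yz.
have dfC (k k' : 'I_d) m : cubical (dfwith z k (z k') m) by case: dfwithP.
rewrite !MVolE //; last 2 first.
- by move=> k ki _; rewrite dfwithout // eq_sym.
- by move=> k _ kj; rewrite dfwithout // eq_sym.
rewrite !dfwithin !dfwithout 1?eq_sym //; last by rewrite eq_sym.
apply: lorentzian_link => //.
- by rewrite cards0 size_map add0n.
- by move=> y; elim: (l) => //= k l' IHl [<-|/IHl].
apply: mvol_gt0 => //.
  by rewrite cards0 add0n /= size_map -[(size l).+2]addn2 l_size.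
by move=> y /= [<-//|[<-//|]]; elim: (l) => //= k l' IHl [<-|/IHl].
Qed.

End Induction.

Lemma mvol2_balanced t (x y : ray Sigma -> R) (c : ray Sigma -> R) : t \in cones Sigma ->
  (forall r, r \in link t -> \sum_(k in link (r |: t)%SET) g k - c r *: g r \in cs t) ->
  mvol t [:: x; y] = \sum_(r in link t) zst t x r *
    (\sum_(k in link (r |: t)%SET) zst t y k - c r * zst t y r).
Proof.
move=> tC bal; rewrite mvol_cons; apply: eq_bigr => r rL; congr (_ * _).
have /linkP[rt rtC] := rL; rewrite mvol_cons.
transitivity (\sum_(k in link (r |: t)%SET) zst t y k -
    zst t y r * \sum_(k in link (r |: t)%SET) zcoef t r k).
  by rewrite mulr_sumr -sumrB; apply: eq_bigr => k _; rewrite zst_setU1 //= mulr1.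
congr (_ - _); rewrite mulrC; congr (_ * _).
rewrite -mulr_suml -ip_sumr.
have := gperp_span r tC (bal r rL); rewrite ipBr ipZr ip_gperp // => /eqP.
by rewrite subr_eq0 => /eqP ->; rewrite mulfK // gt_eqF // gperp_gt0.
Qed.

End Simplicial.

(** * Flats and Bergman fans *)

Section MatroidRank.
Variables (E : finType) (M : matroid E).
Implicit Types (S I J K F G H : {set E}) (e x y : E).
Local Open Scope set_scope.
Local Notation L := (flats M).
Local Notation cl := (cl M).
Local Notation rk := (rk M).

Lemma flatsT : [set: E] \in L.
Proof.
have [F /maxsetP[FL Fmax]] := @ex_maxset _ (fun F => F \in L) (ex_intro _ finset.set0 (flats0 M)).
suff -> : [set: E] = F by [].
apply/eqP; rewrite eq_sym -finset.subTset; apply/fintype.subsetP => e _; apply: contraT => eF.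
have [G [[/minsetP[/andP[GL FG] _] _] _]] := flats_cover FL eF.
have GF := Fmax G GL (proper_sub FG).
by rewrite GF fintype.properxx in FG.
Qed.

Lemma cl_flat S : cl S \in L.
Proof. by rewrite /Defs.cl; elim/big_ind: _ => [|F G|F /andP[]//]; [exact: flatsT|exact: flatsI]. Qed.

Lemma sub_cl S : S \subset cl S.
Proof. by apply/bigcapsP => F /andP[]. Qed.

Lemma cl_sub S F : F \in L -> S \subset F -> cl S \subset F.
Proof. by move=> FL SF; apply: finset.bigcap_inf; rewrite FL. Qed.

Lemma cl_mono S I : S \subset I -> cl S \subset cl I.
Proof. by move=> SI; apply: cl_sub (cl_flat _) _; apply: fintype.subset_trans SI (sub_cl _). Qed.

Lemma cl_id F : F \in L -> cl F = F.
Proof. by move=> FL; apply/eqP; rewrite finset.eqEsubset sub_cl cl_sub. Qed.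

Lemma mem_cl S e : e \in S -> e \in cl S.
Proof. exact: (fintype.subsetP (sub_cl S)). Qed.

Lemma clU1 S e : cl (e |: cl S) = cl (e |: S).
Proof.
apply/eqP; rewrite finset.eqEsubset cl_sub ?cl_flat ?finset.subUset //=; last first.
  rewrite finset.sub1set mem_cl ?finset.setU11 //=; apply: cl_mono; exact: finset.subsetUr.
by apply: cl_mono; apply: finset.setUS; exact: sub_cl.
Qed.

Lemma covers_cl F e : F \in L -> e \notin F -> covers L F (cl (e |: F)).
Proof.
move=> FL eF; have [G [[Gc eG] _]] := flats_cover FL eF.
have /minsetP[/andP[GL FG] Gmin] := Gc.
suff -> : cl (e |: F) = G by [].
have clG : cl (e |: F) \subset G.
  by apply: cl_sub => //; rewrite finset.subUset finset.sub1set eG (proper_sub FG).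
apply: Gmin => //=; rewrite cl_flat /=; apply/properP; split.
  exact: fintype.subset_trans (finset.subsetUr _ _) (sub_cl _).
by exists e => //; rewrite mem_cl ?finset.setU11.
Qed.

Lemma cl_exchange F e x : F \in L -> e \notin F -> x \notin F -> x \in cl (e |: F) ->
  cl (x |: F) = cl (e |: F).
Proof.
move=> FL eF xF xe; have /minsetP[_ Gmin] := covers_cl FL eF.
apply: Gmin; last first.
  apply: cl_sub (cl_flat _) _; rewrite finset.subUset finset.sub1set xe /=.
  exact: fintype.subset_trans (finset.subsetUr _ _) (sub_cl _).
by have /minsetP[] := covers_cl FL xF.
Qed.

Lemma independentP I : reflect (forall x, x \in I -> x \notin cl (I :\ x)) (independent M I).
Proof.
apply: (iffP idP) => [Ii x xI|Ii].
  have /forallP/(_ (I :\ x))/forallP/(_ I)/implyP := Ii.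
  rewrite (properD1 xI) fintype.subxx => /(_ isT) /properP[_ [y yI yx]].
  apply: contra yx => xcl; apply: (fintype.subsetP _ _ yI); apply: cl_sub (cl_flat _) _.
  by rewrite -{1}(finset.setD1K xI) finset.subUset finset.sub1set xcl sub_cl.
apply/forallP => I1; apply/forallP => I2; apply/implyP => /andP[/properP[I12 [x xI2 xI1]] I2I].
apply/properP; split; first exact: cl_mono.
exists x; first exact: mem_cl.
apply: contra (Ii x (fintype.subsetP I2I _ xI2)); apply: (fintype.subsetP _ x); apply: cl_mono.
apply/fintype.subsetP => y yI1; rewrite !inE (fintype.subsetP I2I) ?(fintype.subsetP I12) // andbT.
by apply: contraNneq xI1 => <-.
Qed.

Lemma independentS I J : J \subset I -> independent M I -> independent M J.
Proof.
move=> JI /independentP Ii; apply/independentP => x xJ.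
apply: contra (Ii x (fintype.subsetP JI _ xJ)); apply: (fintype.subsetP _ x).
by apply: cl_mono; apply: finset.setSD.
Qed.

Lemma independentU1 I e : independent M I -> e \notin cl I -> independent M (e |: I).
Proof.
move=> /independentP Ii ecl; have eI : e \notin I by apply: contra ecl => /mem_cl.
apply/independentP => x; rewrite in_setU1 => /predU1P[->|xI]; first by rewrite finset.setU1K.
have xe : x != e by apply: contraNneq eI => <-.
apply: contra ecl => xcl; pose K := cl (I :\ x).
have xK : x \notin K := Ii x xI.
have Kcl : K \subset cl I by apply: cl_mono; exact: finset.subsetDl.
have [eK|eK] := boolP (e \in K); first exact: (fintype.subsetP Kcl).
have -> : cl I = cl (e |: K).
  rewrite -(cl_exchange (cl_flat _) eK xK) ?clU1 ?finset.setD1K //.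
  move: xcl; rewrite (_ : (e |: I) :\ x = e |: (I :\ x)) //.
  by apply/setP => y; rewrite !inE; have [->|//] := eqVneq y e; rewrite eq_sym xe.
by rewrite mem_cl ?finset.setU11.
Qed.

Lemma card_independent I J : independent M J -> J \subset cl I -> (#|J| <= #|I|)%N.
Proof.
elim: {J}_.+1 {-2}J (ltnSn #|J :\: I|) => // n IH J; rewrite ltnS => Jn Ji Jcl.
have [JI|/subsetPn[x xJ xI]] := boolP (J \subset I); first exact: subset_leq_card.
pose K := J :\ x.
have xK : x \notin cl K by exact: (elimT (independentP J) Ji).
have /subsetPn[y yI yK] : ~~ (I \subset cl K).
  apply: contra xK => IK; apply: (fintype.subsetP _ _ (fintype.subsetP Jcl _ xJ)).
  exact: cl_sub (cl_flat _) IK.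
have yK' : y \notin K by apply: contra yK => /mem_cl.
have xx : (#|y |: K| = #|J|)%N by rewrite cardsU1 yK' (cardsD1 x J) xJ.
rewrite -xx; apply: IH.
- apply: leq_trans Jn; rewrite (cardsD1 x (J :\: I)) !inE xI xJ add1n ltnS.
  apply: subset_leq_card; apply/fintype.subsetP => k; rewrite !inE.
  by case/andP=> kI /predU1P[ky|/andP[-> ->]]; [rewrite ky yI in kI|rewrite kI].
- by apply: independentU1 => //; apply: independentS Ji; exact: finset.subsetDl.
- rewrite finset.subUset finset.sub1set mem_cl //=.
  by apply: fintype.subset_trans Jcl; exact: finset.subsetDl.
Qed.

Lemma rk_cl I : independent M I -> rk (cl I) = #|I|.
Proof.
move=> Ii; apply/eqP; rewrite eqn_leq; apply/andP; split.
  by apply/bigmax_leqP => J /andP[Ji Jcl]; exact: card_independent.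
by rewrite /Defs.rk (bigop.bigmax_sup I) // Ii sub_cl.
Qed.

Lemma independent0 : independent M finset.set0.
Proof. by apply/independentP => x; rewrite inE. Qed.

Lemma flat_basis F : F \in L -> exists2 I, independent M I & cl I = F.
Proof.
move=> FL; have P0 : independent M finset.set0 && (finset.set0 \subset F).
  by rewrite independent0 finset.sub0set.
have [I /maxsetP[/andP[Ii IF] Imax]] := ex_maxset (P := fun I => independent M I && (I \subset F))
  (ex_intro _ finset.set0 P0).
exists I => //; apply/eqP; rewrite finset.eqEsubset cl_sub //=.
apply/fintype.subsetP => e eF; apply: contraT => ecl.
have := Imax (e |: I); rewrite independentU1 // finset.subUset finset.sub1set eF IF.
move=> /(_ isT (finset.subsetUr _ _)) IE; move: ecl.
by rewrite mem_cl // -IE finset.setU11.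
Qed.

Lemma rk0 : rk finset.set0 = 0%N.
Proof. by rewrite -{1}(cl_id (flats0 M)) rk_cl ?independent0 // cards0. Qed.

Lemma rkS S I : S \subset I -> (rk S <= rk I)%N.
Proof.
move=> SI; apply/bigmax_leqP => J /andP[Ji JS].
by rewrite /Defs.rk (bigop.bigmax_sup J) // Ji (fintype.subset_trans JS).
Qed.

Lemma rk_clU1 F e : F \in L -> e \notin F -> rk (cl (e |: F)) = (rk F).+1.
Proof.
move=> FL eF; have [I Ii IF] := flat_basis FL.
have eI : e \notin I by apply: contra eF => eI; rewrite -IF mem_cl.
rewrite -IF clU1 !rk_cl ?cardsU1 ?eI //.
by apply: independentU1 => //; rewrite IF.
Qed.

Lemma rk_proper F G : F \in L -> G \in L -> F \proper G -> (rk F < rk G)%N.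
Proof.
move=> FL GL /properP[FG [e eG eF]]; rewrite -(rk_clU1 FL eF); apply: rkS.
by apply: cl_sub => //; rewrite finset.subUset finset.sub1set eG.
Qed.

Lemma rk_eq F G : F \in L -> G \in L -> F \subset G -> (rk G <= rk F)%N -> F = G.
Proof.
move=> FL GL FG GF; apply/eqP; rewrite finset.eqEproper FG.
by apply: contraTN GF; rewrite -ltnNge; exact: rk_proper.
Qed.

Lemma rk_comparable F G : F \in L -> G \in L -> (F \subset G) || (G \subset F) ->
  (F \subset G) = (rk F <= rk G)%N.
Proof.
move=> FL GL /orP[FG|GF]; first by rewrite FG rkS.
apply/idP/idP => [FG|FG]; first exact: rkS.
by rewrite (rk_eq GL FL GF FG).
Qed.

Lemma flat_interpolate F G a : F \in L -> G \in L -> F \subset G -> (rk F <= a <= rk G)%N ->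
  exists H, [/\ H \in L, F \subset H, H \subset G & rk H = a].
Proof.
move=> FL GL FG /andP[Fa]; rewrite -(subnKC Fa); elim: (a - rk F)%N => [|n IH] aG.
  by exists F; rewrite addn0.
have [|H [HL FH HG rkH]] := IH; first by apply: leq_trans aG; rewrite leq_add2l.
have /subsetPn[e eG eH] : ~~ (G \subset H).
  by apply: contraTN aG => GH; rewrite addnS -ltnNge ltnS -rkH rkS.
exists (cl (e |: H)); split; first exact: cl_flat.
- apply: fintype.subset_trans FH _; apply: fintype.subset_trans (sub_cl _); exact: finset.subsetUr.
- by apply: cl_sub => //; rewrite finset.subUset finset.sub1set eG.
- by rewrite rk_clU1 // rkH addnS.
Qed.

End MatroidRank.

Section BergmanFan.
Variables (R : realType) (d : nat) (E : finType) (M : matroid E).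
Variables (N : vectType R) (q : 'Hom({ffun E -> R^o}, N)).
Hypotheses (rkM : matroid_rank M = d.+1) (q_quot : is_quotient_by_vE q).
Local Open Scope set_scope.
Local Notation L := (flats M).
Local Notation cl := (cl M).
Local Notation rk := (rk M).
Local Notation Sig := (bergman_fan M q).
Local Notation v F := (@v_ R E F).

Definition flat_of (r : ray Sig) : {set E} := val (r : {F : {set E} | F \in proper_flats M}).
Local Notation fl := flat_of.
Definition rank_of (r : ray Sig) : nat := rk (fl r).
Local Notation rr := rank_of.
Definition comparable_rays (r k : ray Sig) := (fl r \subset fl k) || (fl k \subset fl r).
Local Notation cmp := comparable_rays.
Implicit Types (t : {set ray Sig}) (r k : ray Sig) (F G H : {set E}) (a : nat).

Lemma genE r : gen r = q (v (fl r)).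
Proof. by []. Qed.

Lemma fl_inj : injective fl.
Proof. by move=> r k /val_inj. Qed.

Lemma fl_flat r : fl r \in L.
Proof. by have := valP (r : {F : {set E} | F \in proper_flats M}); rewrite inE => /andP[]. Qed.

Lemma rkT : rk [set: E] = d.+1.
Proof. exact: rkM. Qed.

Lemma rank_gt0 r : (0 < rr r)%N.
Proof.
have := valP (r : {F : {set E} | F \in proper_flats M}).
rewrite !inE negb_or => /andP[/andP[r0 _] rL].
by rewrite -(rk0 M); apply: rk_proper; rewrite ?flats0 // finset.properEneq eq_sym r0 finset.sub0set.
Qed.

Lemma rank_led r : (rr r <= d)%N.
Proof.
have := valP (r : {F : {set E} | F \in proper_flats M}).
rewrite !inE negb_or => /andP[/andP[_ rT] rL].
by rewrite -ltnS -rkT; apply: rk_proper; rewrite ?flatsT // finset.properEneq rT finset.subsetT.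
Qed.

Lemma ray_of_flat G : G \in L -> (0 < rk G <= d)%N -> exists r, fl r = G.
Proof.
move=> GL /andP[G0 Gd]; have GP : G \in proper_flats M.
  rewrite !inE GL andbT negb_or; apply/andP; split.
    by apply: contraTneq G0 => ->; rewrite rk0.
  by apply: contraTneq Gd => ->; rewrite rkT ltnn.
by exists (exist _ G GP).
Qed.

Lemma coneP_bergman t : reflect (forall r k, r \in t -> k \in t -> cmp r k) (t \in cones Sig).
Proof.
rewrite inE; apply: (iffP forallP) => [H r k rt kt|H r].
  by have /implyP/(_ rt)/forallP/(_ k)/implyP/(_ kt) := H r.
by apply/implyP => rt; apply/forallP => k; apply/implyP => kt; exact: H.
Qed.

Lemma cmpC r k : cmp r k = cmp k r.
Proof. by rewrite /comparable_rays orbC. Qed.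

Lemma cmp_sub r k : cmp r k -> (fl r \subset fl k) = (rr r <= rr k)%N.
Proof. by apply: rk_comparable; exact: fl_flat. Qed.

Lemma cmp_inj r k : cmp r k -> rr r = rr k -> r = k.
Proof.
move=> rk_ e; apply/fl_inj/(rk_eq (fl_flat r) (fl_flat k)); first by rewrite cmp_sub // e.
by rewrite -/(rr k) -/(rr r) e.
Qed.

Lemma linkP_bergman t r : t \in cones Sig ->
  reflect (r \notin t /\ forall k, k \in t -> cmp r k) (r \in link t).
Proof.
move=> /coneP_bergman tC; apply: (iffP (linkP _ _)) => -[rt rC]; split=> //.
  by move=> k kt; move/coneP_bergman: rC; apply; rewrite !inE ?eqxx ?kt ?orbT.
apply/coneP_bergman => k l; rewrite !in_setU1 => /predU1P[->|kt] /predU1P[->|lt].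
- by rewrite /comparable_rays fintype.subxx.
- exact: rC.
- by rewrite cmpC rC.
- exact: tC.
Qed.

Lemma link2P t r k : t \in cones Sig -> r \in link t ->
  reflect [/\ k \in link t, k != r & cmp r k] (k \in link (r |: t)).
Proof.
move=> tC rL; have /linkP[rt rtC] := rL.
apply: (iffP (linkP_bergman _ rtC)) => [[]|[/(linkP_bergman _ tC)[kt kC] kr rk_]].
  rewrite in_setU1 negb_or => /andP[kr kt] kC; split=> //; last by rewrite cmpC kC ?finset.setU11.
  by apply/(linkP_bergman _ tC); split=> // l lt; rewrite kC // in_setU1 lt orbT.
split; first by rewrite in_setU1 negb_or kr.
by move=> l; rewrite in_setU1 => /predU1P[->|/kC//]; rewrite cmpC.
Qed.

Definition lo t a : {set E} := \bigcup_(r in t | (rr r < a)%N) fl r.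
Definition hi t a : {set E} := \bigcap_(r in t | (a < rr r)%N) fl r.

Lemma loP t a : t \in cones Sig -> lo t a = finset.set0 \/
  exists r, [/\ r \in t, (rr r < a)%N & lo t a = fl r].
Proof.
move=> /coneP_bergman tC.
have [/existsP[r0 P0]|/existsPn none] := boolP [exists r, (r \in t) && (rr r < a)%N].
  have [r /andP[rt ra] rmax] := arg_maxnP (P := fun r => (r \in t) && (rr r < a)%N) rr P0.
  right; exists r; split=> //; apply/eqP; rewrite finset.eqEsubset; apply/andP; split.
    apply/bigcupsP => k /andP[kt ka]; rewrite cmp_sub; last exact: tC.
    by apply: rmax; rewrite kt.
  by apply: (finset.bigcup_sup r); rewrite rt.
by left; rewrite /lo big1 // => r rP; have := none r; rewrite rP.
Qed.

Lemma hiP t a : t \in cones Sig -> hi t a = [set: E] \/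
  exists r, [/\ r \in t, (a < rr r)%N & hi t a = fl r].
Proof.
move=> /coneP_bergman tC.
have [/existsP[r0 P0]|/existsPn none] := boolP [exists r, (r \in t) && (a < rr r)%N].
  have [r /andP[rt ra] rmin] := arg_minnP (P := fun r => (r \in t) && (a < rr r)%N) rr P0.
  right; exists r; split=> //; apply/eqP; rewrite finset.eqEsubset; apply/andP; split.
    by apply: (finset.bigcap_inf r); rewrite rt.
  apply/bigcapsP => k /andP[kt ka]; rewrite cmp_sub; last exact: tC.
  by apply: rmin; rewrite kt.
by left; rewrite /hi big1 // => r rP; have := none r; rewrite rP.
Qed.

Lemma lo_flat t a : t \in cones Sig -> lo t a \in L.
Proof. by move=> /(loP a)[->|[r [_ _ ->]]]; [exact: flats0|exact: fl_flat]. Qed.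

Lemma hi_flat t a : t \in cones Sig -> hi t a \in L.
Proof. by move=> /(hiP a)[->|[r [_ _ ->]]]; [exact: flatsT|exact: fl_flat]. Qed.

Lemma rk_lo t a : t \in cones Sig -> (0 < a)%N -> (rk (lo t a) < a)%N.
Proof. by move=> /(loP a)[->|[r [_ ra ->]]] a0; rewrite ?rk0. Qed.

Lemma rk_hi t a : t \in cones Sig -> (a <= d)%N -> (a < rk (hi t a))%N.
Proof. by move=> /(hiP a)[->|[r [_ ra ->]]] a0; rewrite ?rkT. Qed.

Lemma sub_lo t a r : r \in t -> (rr r < a)%N -> fl r \subset lo t a.
Proof. by move=> rt ra; apply: (finset.bigcup_sup r); rewrite rt. Qed.

Lemma hi_sub t a r : r \in t -> (a < rr r)%N -> hi t a \subset fl r.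
Proof. by move=> rt ra; apply: (finset.bigcap_inf r); rewrite rt. Qed.

Lemma lo_sub_hi t a : t \in cones Sig -> lo t a \subset hi t a.
Proof.
move=> /coneP_bergman tC; apply/bigcupsP => r /andP[rt ra]; apply/bigcapsP => k /andP[kt ka].
by rewrite cmp_sub ?tC // ltnW // (ltn_trans ra).
Qed.

Lemma q_vT : q (v [set: E]) = 0.
Proof. by apply/eqP; rewrite -memv_ker q_quot.2 memv_line. Qed.

Lemma v0 : v finset.set0 = 0.
Proof. by apply/ffunP => e; rewrite !ffunE inE. Qed.

Lemma q_lo t a : t \in cones Sig -> q (v (lo t a)) \in cone_span t.
Proof.
move=> /(loP a)[->|[r [rt _ ->]]]; first by rewrite v0 linear0 mem0v.
by rewrite -genE gen_span.
Qed.

Lemma q_hi t a : t \in cones Sig -> q (v (hi t a)) \in cone_span t.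
Proof.
move=> /(hiP a)[->|[r [rt _ ->]]]; first by rewrite q_vT mem0v.
by rewrite -genE gen_span.
Qed.

Lemma simplicial_bergman : simplicial_fan Sig.
Proof.
split=> [s t /coneP_bergman sC /fintype.subsetP ts|t a tC sum0].
  by apply/coneP_bergman => r k rt kt; apply: sC; exact: ts.
have : \sum_(r in t) a r *: v (fl r) \in lker q.
  by rewrite memv_ker linear_sum /= -[X in _ == X]sum0; apply/eqP/eq_bigr => r _; rewrite linearZ.
rewrite q_quot.2 => /vlineP[c cE].
have cE' e : \sum_(r in t) a r * (e \in fl r)%:R = c.
  have := congr1 (fun f : {ffun E -> R^o} => f e) cE; rewrite !ffunE sum_ffunE inE.
  by rewrite [X in _ = X]mulr1 => <-; apply: eq_bigr => r _; rewrite !ffunE.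
have c0 : c = 0.
  have /subsetPn[e _ elo] : ~~ ([set: E] \subset lo t d.+1).
    apply: contraTN (rk_lo tC (ltn0Sn d)) => Tlo.
    by rewrite -leqNgt -{1}rkT rkS.
  rewrite -(cE' e) big1 // => r rt; case: (boolP (e \in fl r)) => er; last by rewrite mulr0.
  move: elo; rewrite (fintype.subsetP (sub_lo rt _)) //.
  by rewrite ltnS rank_led.
move=> r rt; apply/eqP; apply: contraT => ar.
have [{rt ar}r /andP[rt ar] rmax] := arg_maxnP (P := fun r => (r \in t) && (a r != 0)) rr
  (introT andP (conj rt ar)).
have /subsetPn[e er elo] : ~~ (fl r \subset lo t (rr r)).
  by apply: contraTN (rk_lo tC (rank_gt0 r)) => rlo; rewrite -leqNgt; apply: rkS.
have := cE' e; rewrite (bigD1 r) //= er mulr1 big1 ?addr0 => [ar0|k /andP[kt kr]].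
  by move: ar; rewrite ar0 c0 eqxx.
have rk_ : cmp r k by move/coneP_bergman: tC; apply.
have [kr'|rk'] := ltnP (rr k) (rr r).
  case: (boolP (e \in fl k)) => [ek|]; last by rewrite mulr0.
  by move: elo; rewrite (fintype.subsetP (sub_lo kt kr')).
have [->|ak] := eqVneq (a k) 0; first by rewrite mul0r.
have kr'' : (rr k <= rr r)%N by apply: rmax; rewrite kt.
by move: kr; rewrite (cmp_inj rk_) ?eqxx //; apply/eqP; rewrite eqn_leq rk' kr''.
Qed.

Definition missing t a := (0 < a <= d)%N && [forall k in t, rr k != a].

Lemma missingP t a : reflect ((0 < a <= d)%N /\ forall k, k \in t -> rr k != a) (missing t a).
Proof.
apply: (iffP andP) => -[a0 ta]; split=> //; first by move=> k kt; move/forall_inP: ta; exact.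
exact/forall_inP.
Qed.

Lemma link_missing t r : t \in cones Sig -> r \in link t -> missing t (rr r).
Proof.
move=> tC /(linkP_bergman _ tC)[rt rC]; apply/missingP; rewrite rank_gt0 rank_led; split=> // k kt.
apply: contraNneq rt => e; suff -> : r = k by [].
by apply: cmp_inj; [exact: rC|].
Qed.

Lemma lo_sub_link t a r : t \in cones Sig -> r \in link t -> (a <= rr r)%N -> lo t a \subset fl r.
Proof.
move=> tC /(linkP_bergman _ tC)[_ rC] ar; apply/bigcupsP => k /andP[kt ka].
by rewrite cmp_sub ?(leq_trans (ltnW ka)) // cmpC rC.
Qed.

Lemma link_sub_hi t a r : t \in cones Sig -> r \in link t -> (rr r <= a)%N -> fl r \subset hi t a.
Proof.
move=> tC /(linkP_bergman _ tC)[_ rC] ar; apply/bigcapsP => k /andP[kt ka].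
by rewrite cmp_sub ?(leq_trans ar) ?(ltnW ka) // rC.
Qed.

Lemma linkI t a r : t \in cones Sig -> missing t a -> rr r = a ->
  lo t a \subset fl r -> fl r \subset hi t a -> r \in link t.
Proof.
move=> tC /missingP[a0 ta] ra lor rhi; apply/(linkP_bergman _ tC); split.
  by apply/negP => /ta; rewrite ra eqxx.
move=> k kt; have := ta k kt; rewrite neq_ltn => /orP[ka|ak]; apply/orP; [right|left].
  exact: fintype.subset_trans (sub_lo kt ka) lor.
exact: fintype.subset_trans rhi (hi_sub kt ak).
Qed.

Lemma link_ex t a : t \in cones Sig -> missing t a -> exists2 r, r \in link t & rr r = a.
Proof.
move=> tC ta; have /missingP[/andP[a0 ad] _] := ta.
have [|G [GL loG Ghi rkG]] := flat_interpolate (a := a) (lo_flat a tC) (hi_flat a tC) (lo_sub_hi a tC).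
  by apply/andP; split; apply: ltnW; [exact: rk_lo|exact: rk_hi].
have [r rE] : exists r, fl r = G by apply: ray_of_flat; rewrite ?rkG ?a0.
exists r; last by rewrite /rank_of rE.
by apply: (linkI tC ta); rewrite /rank_of ?rE.
Qed.

Lemma card_missing t : t \in cones Sig -> #|[set i : 'I_d | missing t i.+1]%SET| = (d - #|t|)%N.
Proof.
move=> tC; pose f r : 'I_d := Ordinal (leq_trans (eq_leq (prednK (rank_gt0 r))) (rank_led r)).
have fE r : (f r).+1 = rr r by rewrite /= prednK // rank_gt0.
have finj : {in t &, injective f}.
  move=> r k rt kt e; apply: cmp_inj; first by move/coneP_bergman: tC; apply.
  by rewrite -!fE e.
have e := cardsC (f @: t); rewrite (card_in_imset finj) card_ord in e.
transitivity #|~: (f @: t)|; last by rewrite -[in RHS]e addKn.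
suff -> : [set i : 'I_d | missing t i.+1]%SET = ~: (f @: t) by [].
apply/setP => i; rewrite !inE /missing ltn_ord /=.
apply/forall_inP/idP => [H|/imsetP H r rt].
  by apply/imsetP => -[r rt iE]; have := H r rt; rewrite -fE iE eqxx.
by apply/eqP => e'; apply: H; exists r => //; apply/val_inj/eqP; rewrite -eqSS fE e'.
Qed.

Lemma missing_ord t a : missing t a -> exists i : 'I_d, i.+1 = a.
Proof. by move=> /missingP[/andP[a0 ad] _]; case: a a0 ad => // a _ ad; exists (Ordinal ad). Qed.

Lemma link_neq0_bergman t : t \in cones Sig -> (#|t| < d)%N -> link t != finset.set0.
Proof.
move=> tC td; have : (0 < #|[set i : 'I_d | missing t i.+1]%SET|)%N by rewrite card_missing ?subn_gt0.
case/card_gt0P => i; rewrite inE => /(link_ex tC)[r rL _].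
by apply/set0Pn; exists r.
Qed.

Lemma rk_lo_eq t a : t \in cones Sig -> (0 < a)%N ->
  a = 1%N \/ (exists2 k, k \in t & (rr k).+1 = a) -> (rk (lo t a)).+1 = a.
Proof.
move=> tC a0 h; apply/eqP; rewrite eqn_leq rk_lo //=; case: h => [->|[k kt <-]] //.
by rewrite ltnS rkS // sub_lo.
Qed.

Lemma rk_hi_eq t a : t \in cones Sig -> (a <= d)%N ->
  a = d \/ (exists2 k, k \in t & rr k = a.+1) -> rk (hi t a) = a.+1.
Proof.
move=> tC ad h; apply/eqP; rewrite eqn_leq rk_hi // andbT; case: h => [->|[k kt kE]].
  by rewrite -rkT rkS // finset.subsetT.
by rewrite -kE rkS // hi_sub // kE.
Qed.

Lemma not_missing t a : (0 < a <= d)%N -> ~~ missing t a -> exists2 k, k \in t & rr k = a.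
Proof.
move=> a0; rewrite /missing a0 /= negb_forall => /existsP[k].
by rewrite negb_imply negbK => /andP[kt /eqP <-]; exists k.
Qed.

Lemma cover_join F G H : F \in L -> G \in L -> H \in L -> F \subset G -> F \subset H ->
  rk G = (rk F).+1 -> rk H = (rk F).+1 -> G != H ->
  exists J, [/\ J \in L, G \subset J, H \subset J, rk J = (rk F).+2 &
    forall K, K \in L -> G \subset K -> H \subset K -> J \subset K].
Proof.
move=> FL GL HL FG FH rG rH GH.
have /subsetPn[e eH eG] : ~~ (H \subset G).
  by apply: contra GH => HG; rewrite eq_sym (rk_eq HL GL HG) ?rG ?rH.
have eF : e \notin F by apply: contra eG; exact: (fintype.subsetP FG).
have HE : H = cl (e |: F).
  apply/esym/(rk_eq (cl_flat M _) HL); rewrite ?rk_clU1 ?rH //.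
  by apply: cl_sub => //; rewrite finset.subUset finset.sub1set eH.
exists (cl (e |: G)); split; rewrite ?cl_flat ?rk_clU1 ?rG //.
- by apply: fintype.subset_trans (sub_cl _ _); exact: finset.subsetUr.
- by rewrite HE; apply: cl_mono; exact: finset.setUS.
- move=> K KL GK HK; apply: cl_sub => //; rewrite finset.subUset finset.sub1set GK andbT.
  exact: (fintype.subsetP HK).
Qed.

(* Rays of the smallest missing rank a are joined through a ray of rank a + 1 if
   this rank is missing, and otherwise lie below the ray of t of rank a + 1, hence
   below any ray of a larger missing rank. *)
Lemma link_conn_bergman t : t \in cones Sig -> (#|t| + 3 <= d)%N -> forall f : ray Sig -> R,
  (forall r k, r \in link t -> k \in link (r |: t) -> f r = f k) ->
  forall r k, r \in link t -> k \in link t -> f r = f k.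
Proof.
move=> tC td f fc.
have fcmp r k : r \in link t -> k \in link t -> cmp r k -> f r = f k.
  move=> rL kL rk_; have [->//|kr] := eqVneq k r.
  by apply: fc => //; apply/link2P.
have /card_gt1P[i [j [iM jM ij]]] : (1 < #|[set i : 'I_d | missing t i.+1]%SET|)%N.
  by rewrite card_missing //; lia.
rewrite !inE in iM jM.
have [a0 a0M amin] := arg_minnP (P := fun i : 'I_d => missing t i.+1) val iM.
have [b bM ab] : exists2 b : 'I_d, missing t b.+1 & (a0 < b)%N.
  have [e|ne] := eqVneq i a0; [exists j|exists i] => //; rewrite ltn_neqAle amin // andbT.
    by rewrite -e.
  by rewrite eq_sym.
set a := a0.+1 in a0M *.
have below c : (0 < c < a)%N -> exists2 k, k \in t & rr k = c.
  move=> /andP[c0 ca]; apply: not_missing.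
    by rewrite c0 (leq_trans _ (ltnW (ltn_ord a0))).
  apply/negP => cM; have [c' cE] := missing_ord cM.
  by move: ca cM; rewrite -cE ltnS => ca /amin; rewrite leqNgt ca.
have rklo : (rk (lo t a)).+1 = a.
  apply: rk_lo_eq => //; case: (posnP a0) => [a00|a00]; [left|right]; first by rewrite /a a00.
  by have [|k kt kE] := below a0; [rewrite a00 /=|exists k => //; rewrite kE].
have same r k : r \in link t -> k \in link t -> rr r = a -> rr k = a -> f r = f k.
  move=> rL kL ra ka; have [->//|rk_] := eqVneq r k.
  have [a1M|a1N] := boolP (missing t a.+1).
    have flrk : fl r != fl k by apply: contraNneq rk_ => /fl_inj ->.
    have [||||||||J [JL rJ kJ rkJ Jmin]] := @cover_join (lo t a) (fl r) (fl k);
      rewrite ?lo_flat ?fl_flat ?lo_sub_link ?ra ?ka ?rklo //.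
    have /missingP[a1d _] := a1M.
    have [s sE] : exists s, fl s = J by apply: ray_of_flat; rewrite ?rkJ ?rklo.
    have rs : rr s = a.+1 by rewrite /rank_of sE rkJ rklo.
    have sL : s \in link t.
      apply: (linkI tC a1M rs); rewrite sE.
        apply: fintype.subset_trans rJ; apply/bigcupsP => l /andP[lt la].
        apply: (fintype.subset_trans (sub_lo (a := a) lt _)); last by rewrite lo_sub_link ?ra.
        by have /missingP[_ /(_ l lt) la'] := a0M; rewrite ltn_neqAle la'.
      apply/bigcapsP => l /andP[lt la]; apply: Jmin; rewrite ?fl_flat //.
        by apply: (fintype.subset_trans (link_sub_hi (a := a) tC rL _)); rewrite ?ra // hi_sub // ltnW.
      by apply: (fintype.subset_trans (link_sub_hi (a := a) tC kL _)); rewrite ?ka // hi_sub // ltnW.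
    transitivity (f s); first by apply: fcmp; rewrite // /comparable_rays sE rJ.
    by apply: fcmp; rewrite // /comparable_rays sE kJ orbT.
  have [|h ht hE] := not_missing _ a1N; first exact: (leq_ltn_trans ab (ltn_ord b)).
  have [s sL sE] := link_ex tC bM.
  have /missingP[_ /(_ h ht) hb] := bM.
  have sh : fl h \subset fl s.
    rewrite cmp_sub; last by rewrite cmpC; have /(linkP_bergman _ tC)[_ ->] := sL.
    by rewrite hE sE ltnS.
  have sub l : l \in link t -> rr l = a -> fl l \subset fl s.
    move=> lL la; apply: fintype.subset_trans sh; rewrite cmp_sub ?la ?hE //.
    by have /(linkP_bergman _ tC)[_ ->] := lL.
  transitivity (f s); first by apply: fcmp; rewrite // /comparable_rays sub.
  by apply: fcmp; rewrite // /comparable_rays sub ?orbT.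
have to_a r : r \in link t -> exists k, [/\ k \in link t, rr k = a & f r = f k].
  move=> rL; have [ra|ra] := eqVneq (rr r) a; first by exists r.
  have /linkP[rt rtC] := rL.
  have aM : missing (r |: t) a.
    have /missingP[a0d ta] := a0M; apply/missingP; split=> // l.
    by rewrite in_setU1 => /predU1P[->|/ta].
  have [k kL ka] := link_ex rtC aM; exists k; split=> //; last exact: fc.
  by have /(link2P _ tC rL)[] := kL.
move=> r k /to_a[r' [r'L r'a ->]] /to_a[k' [k'L k'a ->]].
exact: same.
Qed.

Lemma cover_sum (X : {set ray Sig}) F H : F \in L -> H \in L -> F \subset H ->
  ((rk F).+1 < rk H)%N ->
  (forall r, (r \in X) = [&& F \subset fl r, fl r \subset H & rr r == (rk F).+1]) ->
  \sum_(r in X) (v (fl r) - v F) = v H - v F.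
Proof.
move=> FL HL FH rFH XE; apply/ffunP => e; rewrite sum_ffunE !ffunE.
have [eF|eF] := boolP (e \in F).
  rewrite (fintype.subsetP FH) // subrr big1 // => r; rewrite XE => /and3P[Fr _ _].
  by rewrite !ffunE (fintype.subsetP Fr) // eF subrr.
have [eH|eH] := boolP (e \in H); last first.
  rewrite big1 ?subrr // => r; rewrite XE => /and3P[_ rH _].
  by rewrite !ffunE (negPf eF) (contraNF (fintype.subsetP rH e)) ?subrr.
have [r0 r0E] : exists r0, fl r0 = cl (e |: F).
  apply: ray_of_flat; rewrite ?cl_flat // rk_clU1 //= -ltnS -rkT.
  by apply: leq_trans rFH _; rewrite rkS // finset.subsetT.
have Fcl : F \subset cl (e |: F).
  by apply: fintype.subset_trans (sub_cl _ _); exact: finset.subsetUr.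
have clH : cl (e |: F) \subset H.
  by apply: cl_sub => //; rewrite finset.subUset finset.sub1set eH.
have r0X : r0 \in X by rewrite XE /rank_of r0E rk_clU1 // eqxx Fcl clH.
rewrite (bigD1 r0) //= !ffunE r0E mem_cl ?finset.setU11 // (negPf eF) big1 ?addr0 // => r /andP[rX rr0].
move: rX; rewrite XE => /and3P[Fr rH /eqP rkr]; rewrite !ffunE (negPf eF).
case: (boolP (e \in fl r)) => er; last by rewrite subrr.
case/eqP: rr0; apply: fl_inj; rewrite r0E; apply/esym/(rk_eq (cl_flat M _) (fl_flat r)).
  by apply: cl_sub (fl_flat r) _; rewrite finset.subUset finset.sub1set er.
by rewrite rk_clU1 // -/(rr r) rkr.
Qed.

Lemma gen_cover_sum (X : {set ray Sig}) F H : F \in L -> H \in L -> F \subset H ->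
  ((rk F).+1 < rk H)%N ->
  (forall r, (r \in X) = [&& F \subset fl r, fl r \subset H & rr r == (rk F).+1]) ->
  \sum_(r in X) gen r = q (v H) + (#|X|%:R - 1) *: q (v F).
Proof.
move=> FL HL FH rFH XE; have := congr1 q (cover_sum FL HL FH rFH XE).
rewrite linear_sum /= (eq_bigr (fun r => gen r - q (v F))) => [|r _]; last by rewrite linearB.
rewrite sumrB sumr_const linearB /= => /eqP; rewrite subr_eq => /eqP ->.
by rewrite scalerBl scale1r scaler_nat -addrA [- _ + _]addrC.
Qed.

Definition level t a : {set ray Sig} := [set r in link t | rr r == a]%SET.

Lemma in_level t a r : (r \in level t a) = (r \in link t) && (rr r == a).
Proof. by rewrite finset.in_set. Qed.

Lemma levelE t a r : t \in cones Sig -> missing t a -> (rk (lo t a)).+1 = a ->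
  (r \in level t a) = [&& lo t a \subset fl r, fl r \subset hi t a & rr r == (rk (lo t a)).+1].
Proof.
move=> tC aM ->; rewrite in_level; apply/andP/and3P => [[rL /eqP ra]|[lor rhi /eqP ra]].
  by rewrite lo_sub_link ?link_sub_hi ?ra ?eqxx.
by rewrite (linkI tC aM) ?ra.
Qed.

Section TwoMissing.
Variables (ip : {dot N for idfun}) (t : {set ray Sig}) (a b : nat).
Hypotheses (tC : t \in cones Sig) (ab : (a < b)%N) (aM : missing t a) (bM : missing t b)
  (only : forall c, missing t c -> c = a \/ c = b).
Local Notation A := (level t a).
Local Notation B := (level t b).

Let a0 : (0 < a)%N. Proof. by have /missingP[/andP[]] := aM. Qed.
Let bd : (b <= d)%N. Proof. by have /missingP[/andP[]] := bM. Qed.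
Let aN : a != b. Proof. by rewrite ltn_eqF. Qed.

Lemma sum_levels (V : zmodType) (f : ray Sig -> V) :
  \sum_(r in link t) f r = \sum_(r in A) f r + \sum_(r in B) f r.
Proof.
rewrite (bigID (fun r => rr r == a)) /=; congr (_ + _); apply: eq_bigl => r; rewrite in_level //.
case rL : (r \in link t) => //=; have [->|->] := only (link_missing tC rL).
  by rewrite eqxx (negPf aN).
by rewrite eqxx eq_sym aN.
Qed.

Lemma link_levelA r k : r \in A -> (k \in link (r |: t)) = (k \in B) && (fl r \subset fl k).
Proof.
rewrite in_level => /andP[rL /eqP ra].
apply/(link2P _ tC rL)/andP => [[kL kr rk_]|[]]; rewrite in_level.
  have kb : rr k = b.
    have [ka|//] := only (link_missing tC kL).
    by case/eqP: kr; apply: cmp_inj; rewrite ?ra // cmpC.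
  by rewrite kL kb eqxx cmp_sub // ra kb ltnW.
move=> /andP[kL /eqP kb] rk_; split=> //; last by rewrite /comparable_rays rk_.
by apply: contraNneq aN => e; rewrite -ra -kb e.
Qed.

Lemma link_levelB r k : k \in B -> (r \in link (k |: t)) = (r \in A) && (fl r \subset fl k).
Proof.
rewrite in_level => /andP[kL /eqP kb].
apply/(link2P _ tC kL)/andP => [[rL rk_ kr]|[]]; rewrite in_level.
  have ra : rr r = a.
    have [//|rb] := only (link_missing tC rL).
    by case/eqP: rk_; apply: cmp_inj; rewrite ?kb // cmpC.
  by rewrite cmpC in kr; rewrite rL ra eqxx cmp_sub // ra kb ltnW.
move=> /andP[rL /eqP ra] rk_; split=> //; last by rewrite /comparable_rays rk_ orbT.
by apply: contraNneq aN => e; rewrite -ra -kb e.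
Qed.

Let rk_loa : (rk (lo t a)).+1 = a.
Proof.
apply: rk_lo_eq => //; case: a a0 aM ab only => [//|[|c]] _ _ cb onl; [by left|right].
have [||k kt kE] := @not_missing t c.+1; first by rewrite /= (leq_trans (ltnW (ltnW cb))).
  apply/negP => /onl[/eqP|cE]; first by rewrite ltn_eqF.
  by rewrite -cE ltnNge ltnW in cb.
by exists k => //; rewrite kE.
Qed.

Let rk_hib : rk (hi t b) = b.+1.
Proof.
apply: rk_hi_eq => //; have [->|bd'] := eqVneq b d; [by left|right].
apply: not_missing; first by rewrite /= ltn_neqAle bd'.
apply/negP => /only[e|/eqP]; last by rewrite gtn_eqF.
by move: ab; rewrite -e ltnNge leqW.
Qed.

(* Here the link is the join of A and B, so the form is twice a product of two
   linear functionals. *)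
Lemma lorentzian_apart : (a.+1 < b)%N -> lorentzian ip t [::].
Proof.
move=> a1b.
have rk_hia : rk (hi t a) = a.+1.
  apply: rk_hi_eq => //; first exact: ltnW (leq_trans ab bd).
  right; apply: not_missing; first by rewrite /= (leq_trans ab).
  by apply/negP => /only[/eqP|e]; [rewrite gtn_eqF|rewrite e ltnn in a1b].
have [b' bE] : exists b', b = b'.+1 by case: b a1b => // b' _; exists b'.
have [h ht hE] : exists2 h, h \in t & rr h = b'.
  have [a_b' b'_b] : (a < b')%N /\ (b' < b)%N by rewrite bE in a1b *.
  apply: not_missing; first by rewrite (leq_ltn_trans _ a_b') //= (leq_trans (ltnW b'_b)).
  by apply/negP => /only[] e; [rewrite e ltnn in a_b'|rewrite e ltnn in b'_b].
have rk_lob : (rk (lo t b)).+1 = b.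
  by apply: rk_lo_eq => //; [exact: leq_ltn_trans ab|right; exists h => //; rewrite hE].
have AB r k : r \in A -> k \in B -> fl r \subset fl k.
  rewrite !in_level => /andP[rL /eqP ra] /andP[kL /eqP kb].
  have /(linkP_bergman _ tC)[_ rC] := rL; have /(linkP_bergman _ tC)[_ kC] := kL.
  apply: (@fintype.subset_trans _ _ (mem (fl h))).
    by rewrite cmp_sub ?rC // ra hE -ltnS -bE ltnW.
  by rewrite cmp_sub; [rewrite kb hE bE|rewrite cmpC kC].
have linkA r : r \in A -> link (r |: t) = B.
  move=> rA; apply/setP => k; rewrite link_levelA //.
  by apply/andP/idP => [[]//|kB]; split=> //; exact: AB.
have linkB k : k \in B -> link (k |: t) = A.
  move=> kB; apply/setP => r; rewrite link_levelB //.
  by apply/andP/idP => [[]//|rA]; split=> //; exact: AB.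
have span_level c : missing t c -> (rk (lo t c)).+1 = c -> rk (hi t c) = c.+1 ->
    \sum_(k in level t c) gen k \in cone_span t.
  move=> cM loc hic; rewrite (@gen_cover_sum _ (lo t c) (hi t c)).
  - by rewrite memvD ?memvZ ?q_lo ?q_hi.
  - exact: lo_flat.
  - exact: hi_flat.
  - exact: lo_sub_hi.
  - by rewrite loc hic.
  - by move=> r; rewrite levelE.
have mvolE (x y : ray Sig -> R) : mvol ip t [:: x; y] =
    (\sum_(r in A) zst ip t x r) * (\sum_(k in B) zst ip t y k) +
    (\sum_(r in B) zst ip t x r) * (\sum_(k in A) zst ip t y k).
  rewrite (@mvol2_balanced _ _ _ ip simplicial_bergman t x y (fun=> 0)) //; last first.
    move=> r rL; rewrite scale0r subr0.
    have [ra|rb] := only (link_missing tC rL).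
      by rewrite linkA ?in_level ?rL ?ra ?eqxx // span_level.
    by rewrite linkB ?in_level ?rL ?rb ?eqxx // span_level.
  rewrite sum_levels; congr (_ + _); rewrite mulr_suml; apply: eq_bigr => r rL.
    by rewrite mul0r subr0 linkA.
  by rewrite mul0r subr0 linkB.
apply: (@lorentzian_of_functional _ _ _ ip simplicial_bergman t [::]
  (fun x => \sum_(r in A) zst ip t x r)) => //.
  move=> c x c' y; rewrite !mulr_sumr -big_split; apply: eq_bigr => r _.
  by rewrite /= (zst_lin ip simplicial_bergman).
by move=> y yA; rewrite mvolE yA mul0r mulr0 addr0.
Qed.

(* Two elements of A lie below exactly one element of B, which turns the form
   into (sum_A z_r)^2 - sum_B (z_k - sum_(r < k) z_r)^2. *)
Lemma lorentzian_adjacent : b = a.+1 -> lorentzian ip t [::].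
Proof.
move=> bE.
pose inc r k : bool := fl r \subset fl k.
pose T r : {set ray Sig} := [set k in B | inc r k]%SET.
pose S k : {set ray Sig} := [set r in A | inc r k]%SET.
have linkA r : r \in A -> link (r |: t) = T r.
  by move=> rA; apply/setP => k; rewrite link_levelA // [RHS]inE.
have linkB k : k \in B -> link (k |: t) = S k.
  by move=> kB; apply/setP => r; rewrite link_levelB // [RHS]inE.
have loB r k : r \in A -> inc r k -> lo t b \subset fl k.
  rewrite in_level => /andP[rL /eqP ra] rk_; apply: fintype.subset_trans rk_.
  apply/bigcupsP => l /andP[lt]; rewrite bE ltnS => la.
  apply: fintype.subset_trans (lo_sub_link (a := a) tC rL _); last by rewrite ra.
  by apply: sub_lo => //; rewrite ltn_neqAle la andbT; have /missingP[_ ->] := aM.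
have hiA r k : k \in B -> inc r k -> fl r \subset hi t a.
  rewrite in_level => /andP[kL /eqP kb] rk_; apply: (fintype.subset_trans rk_).
  apply/bigcapsP => l /andP[lt la].
  apply: fintype.subset_trans (link_sub_hi (a := b) tC kL _) _; first by rewrite kb.
  by apply: hi_sub => //; rewrite ltn_neqAle eq_sym bE la -bE; have /missingP[_ ->] := bM.
have genT r : r \in A -> \sum_(k in T r) gen k = q (v (hi t b)) + (#|T r|%:R - 1) *: gen r.
  move=> rA; have := rA; rewrite in_level => /andP[rL /eqP ra].
  rewrite (@gen_cover_sum _ (fl r) (hi t b)) -/(rr r) ?ra //.
  - exact: fl_flat.
  - exact: hi_flat.
  - by rewrite (link_sub_hi (a := b)) // ra ltnW.
  - by rewrite rk_hib bE.
  move=> k; rewrite inE -bE; apply/andP/and3P => [[]|[rk_ khi /eqP kb]].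
    by rewrite in_level => /andP[kL /eqP kb] rk_; rewrite kb eqxx (link_sub_hi (a := b)) // kb.
  split=> //; rewrite in_level kb eqxx andbT; apply: (linkI tC bM) => //; exact: loB rA rk_.
have genS k : k \in B -> \sum_(r in S k) gen r = gen k + (#|S k|%:R - 1) *: q (v (lo t a)).
  move=> kB; have := kB; rewrite in_level => /andP[kL /eqP kb].
  rewrite (@gen_cover_sum _ (lo t a) (fl k)) //.
  - exact: lo_flat.
  - exact: fl_flat.
  - by rewrite lo_sub_link // kb ltnW.
  - by rewrite rk_loa -/(rr k) kb.
  move=> r; rewrite inE rk_loa; apply/andP/and3P => [[]|[lor rk_ /eqP ra]].
    by rewrite in_level => /andP[rL /eqP ra] rk_; rewrite ra eqxx (lo_sub_link tC rL) // ra.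
  split=> //; rewrite in_level ra eqxx andbT; apply: (linkI tC aM) => //; exact: hiA kB rk_.
pose c r : R := if rr r == a then #|T r|%:R - 1 else 1.
have mvolE (y : ray Sig -> R) : mvol ip t [:: y; y] =
    \sum_(r in A) zst ip t y r *
      (\sum_(k in T r) zst ip t y k - (#|T r|%:R - 1) * zst ip t y r) +
    \sum_(k in B) zst ip t y k * (\sum_(r in S k) zst ip t y r - zst ip t y k).
  rewrite (@mvol2_balanced _ _ _ ip simplicial_bergman t y y c) //; last first.
    move=> r rL; rewrite /c; have [ra|rb] := only (link_missing tC rL).
      have rA : r \in A by rewrite in_level rL ra eqxx.
      by rewrite ra eqxx linkA // genT // addrK q_hi.
    have rB : r \in B by rewrite in_level rL rb eqxx.
    by rewrite rb eq_sym (negPf aN) linkB // genS // scale1r addrAC subrr add0r memvZ ?q_lo.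
  rewrite sum_levels; congr (_ + _); apply: eq_bigr => r rL.
    by rewrite linkA // /c; move: rL; rewrite in_level => /andP[_ ->].
  rewrite linkB // /c; move: rL; rewrite in_level => /andP[_ /eqP ->].
  by rewrite eq_sym (negPf aN) mul1r.
have joins r r' : r \in A -> r' \in A -> r != r' ->
    \sum_(k in B) (inc r k && inc r' k)%:R = 1 :> R.
  move=> rA r'A rr'.
  have := rA; have := r'A; rewrite !in_level => /andP[r'L /eqP r'a] /andP[rL /eqP ra].
  have flrr' : fl r != fl r' by apply: contraNneq rr' => /fl_inj ->.
  have [||||||||J [JL rJ r'J rkJ Jmin]] := @cover_join (lo t a) (fl r) (fl r');
    rewrite ?lo_flat ?fl_flat ?lo_sub_link ?ra ?r'a ?rk_loa //.
  have rkJ' : rk J = b by rewrite rkJ rk_loa bE.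
  have [k kE] : exists k, fl k = J.
    by apply: ray_of_flat; rewrite ?rkJ' // bd bE.
  have kB : k \in B.
    rewrite in_level /rank_of kE rkJ' eqxx andbT; apply: (linkI tC bM).
    - by rewrite /rank_of kE.
    - by apply: loB rA _; rewrite /inc kE.
    - rewrite kE; apply: Jmin; rewrite ?hi_flat //.
        by rewrite (link_sub_hi tC rL) // ra ltnW.
      by rewrite (link_sub_hi tC r'L) // r'a ltnW.
  rewrite (bigD1 k) //= /inc kE rJ r'J big1 ?addr0 // => k' /andP[k'B k'k].
  case: (boolP (_ && _)) => // /andP[rk' r'k'].
  case/eqP: k'k; apply: fl_inj; rewrite kE; apply/esym/(rk_eq JL (fl_flat k')).
    by apply: Jmin; rewrite ?fl_flat.
  by move: k'B; rewrite in_level -/(rr k') => /andP[_ /eqP ->]; rewrite rkJ'.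
apply: (@lorentzian_of_functional _ _ _ ip simplicial_bergman t [::]
  (fun x => \sum_(r in A) zst ip t x r)) => //.
  move=> e x e' y; rewrite !mulr_sumr -big_split; apply: eq_bigr => r _.
  by rewrite /= (zst_lin ip simplicial_bergman).
move=> y yA; pose z r := zst ip t y r.
have sumS k : \sum_(r in S k) z r = \sum_(r in A) (inc r k)%:R * z r.
  rewrite [LHS](eq_bigl (fun r => (r \in A) && inc r k)) => [|r]; last by rewrite finset.in_set.
  by rewrite big_mkcondr; apply: eq_bigr => r _; case: (inc r k); rewrite ?mul1r ?mul0r.
have sumT r (f : ray Sig -> R) : \sum_(k in T r) f k = \sum_(k in B) (inc r k)%:R * f k.
  rewrite [LHS](eq_bigl (fun k => (k \in B) && inc r k)) => [|k]; last by rewrite finset.in_set.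
  by rewrite big_mkcondr; apply: eq_bigr => k _; case: (inc r k); rewrite ?mul1r ?mul0r.
have cardT r : #|T r|%:R = \sum_(k in B) (inc r k)%:R :> R.
  rewrite -sum1_card natr_sum sumT; apply: eq_bigr => k _; exact: mulr1.
have squares : \sum_(k in B) (\sum_(r in S k) z r) ^+ 2 =
    (\sum_(r in A) z r) ^+ 2 + \sum_(r in A) (#|T r|%:R - 1) * z r ^+ 2.
  transitivity (\sum_(r in A) \sum_(r' in A)
      z r * z r' * \sum_(k in B) (inc r k && inc r' k)%:R).
    under eq_bigr do rewrite sumS expr2 mulr_suml; rewrite exchange_big; apply: eq_bigr => r _.
    under eq_bigr do rewrite mulr_sumr; rewrite exchange_big; apply: eq_bigr => r' _.
    rewrite mulr_sumr; apply: eq_bigr => k _.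
    by case: (inc r k); case: (inc r' k); rewrite /= ?mul0r ?mulr0 ?mul1r ?mulr1.
  rewrite expr2 mulr_suml -big_split; apply: eq_bigr => r rA.
  rewrite mulr_sumr (bigD1 r) //= [in RHS](bigD1 r) //=.
  rewrite (eq_bigr (fun k => (inc r k)%:R)) => [|k _]; last by rewrite andbb.
  rewrite [X in _ + X = _](eq_bigr (fun r' => z r * z r')) => [|r' /andP[r'A r'r]]; last first.
    by rewrite joins ?mulr1 // eq_sym.
  by rewrite -cardT; ring.
rewrite mvolE -/(z _).
have -> : \sum_(r in A) z r * (\sum_(k in T r) z k - (#|T r|%:R - 1) * z r) =
    \sum_(k in B) z k * (\sum_(r in S k) z r) - \sum_(k in B) (\sum_(r in S k) z r) ^+ 2.
  rewrite squares yA expr0n add0r.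
  have -> : \sum_(k in B) z k * (\sum_(r in S k) z r) = \sum_(r in A) z r * (\sum_(k in T r) z k).
    under eq_bigr do rewrite sumS mulr_sumr; rewrite exchange_big; apply: eq_bigr => r _.
    by rewrite sumT mulr_sumr; apply: eq_bigr => k _; ring.
  by rewrite -sumrB; apply: eq_bigr => r _; ring.
rewrite -sumrB -big_split /= sumr_le0 // => k _.
set m := \sum_(r in S k) z r; rewrite -[X in X <= 0]/(z k * m - m ^+ 2 + z k * (m - z k)).
rewrite [X in X <= 0](_ : _ = - (z k - m) ^+ 2); last by ring.
by rewrite oppr_le0 sqr_ge0.
Qed.

End TwoMissing.

Lemma lorentzian2_bergman (ip : {dot N for idfun}) t : t \in cones Sig -> (#|t| + 2)%N = d ->
  lorentzian ip t [::].
Proof.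
move=> tC td; have : #|[set i : 'I_d | missing t i.+1]%SET| == 2%N by rewrite card_missing //; lia.
case/cards2P => i [j [ij /setP mE]].
have iM : missing t i.+1 by have := mE i; rewrite !inE eqxx.
have jM : missing t j.+1 by have := mE j; rewrite !inE eqxx orbT.
have only c : missing t c -> c = i.+1 \/ c = j.+1.
  move=> cM; have [k kE] := missing_ord cM; have := mE k; rewrite !inE kE cM -kE.
  by move=> /esym/orP[/eqP ->|/eqP ->]; [left|right].
have main a b : (a < b)%N -> missing t a -> missing t b ->
    (forall c, missing t c -> c = a \/ c = b) -> lorentzian ip t [::].
  move=> ab aM bM onl; have [a1b|] := ltnP a.+1 b; first exact: lorentzian_apart tC ab aM bM onl a1b.
  by move=> ba; apply: (lorentzian_adjacent tC ab aM bM onl); apply/eqP; rewrite eqn_leq ba ab.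
move: ij; rewrite -val_eqE neq_ltn => /orP[ij|ji]; first exact: (main i.+1 j.+1).
by apply: (main j.+1 i.+1) => // c /only[]; [right|left].
Qed.

End BergmanFan.

Theorem theorem6p2 (R : realType) (d : nat) (E : finType) (M : matroid E)
    (N : vectType R) (q : 'Hom({ffun E -> R^o}, N))
    (ip : {dot N for idfun}) :
  (2 <= d)%N -> matroid_rank M = d.+1 -> is_quotient_by_vE q ->
  Cub (bergman_fan M q) ip !=set0 ->
  AF (bergman_fan M q) ip d.
Proof.
move=> d2 rkM q_quot _.
apply: (AF_of_link_conditions (simplicial_bergman rkM q_quot)) => //.
- exact: (link_neq0_bergman rkM).
- exact: (link_conn_bergman rkM).
- exact: (lorentzian2_bergman rkM q_quot).
- by apply/coneP_bergman => r k; rewrite inE.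
Qed.
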